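(* Let $d\ge 1$ be an integer, $a>0$ and $0<\epsilon<a/4$, and let $\Gamma$ be a connected simplicial complex with $n\ge 1$ vertices. For $\lambda>0$ let $\omega$ be a Poisson point process on the torus $\mathbb{T}_a^d$ with intensity measure $\Lambda=\lambda\,dx$, and let $G_\Gamma=G_\Gamma(\omega)$ be the number of occurrences of $\Gamma$ in $\mathcal{C}_\epsilon(\omega)$. Then there exists $c>0$ (not depending on $\lambda$) such that for every $\lambda\ge 1$, $$d_W\left(\frac{G_\Gamma-\mathbf{E}_\Lambda[G_\Gamma]}{\sqrt{\operatorname{Var}_\Lambda[G_\Gamma]}},\ \mathcal{N}(0,1)\right)\le\frac{c}{\lambda^{1/2}},$$ where $d_W$ is the Wasserstein distance between probability laws on $\mathbb{R}$.
   Context: $\mathbb{T}_a^d=\mathbb{R}^d/a\mathbb{Z}^d$, identified with $X=[0,a)^d$, is equipped with Lebesgue measure and the distance $\rho_d(x,y)=\inf_{m\in\mathbb{Z}^d}\|x-y+ma\|_\infty$. $\mathcal{C}_\epsilon(\omega)$ is the Čech complex of the open $\rho_d$-balls of radius $\epsilon$ centred at the points of $\omega$; two distinct points of $\omega$ are joined by an edge iff their distance is $<2\epsilon$. A complex $\Gamma$ is regarded as appearing as soon as its edges appear. Precisely, label the vertices of $\Gamma$ by $1,\dots,n$, let $J_\Gamma\subset\{1,\dots,n\}^2$ be its set of edges, and put $$\widetilde{h^\Gamma}(v_1,\dots,v_n)=\frac{1}{c_\Gamma}\prod_{(i,j)\in J_\Gamma}\mathbf{1}_{\{\rho_d(v_i,v_j)<2\epsilon\}},$$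 where $c_\Gamma$ is the number of permutations $\sigma$ of $\{1,\dots,n\}$ such that $\widetilde{h^\Gamma}(v_1,\dots,v_n)=\widetilde{h^\Gamma}(v_{\sigma(1)},\dots,v_{\sigma(n)})$ identically (i.e. the number of automorphisms of the edge graph of $\Gamma$). Let $f^\Gamma$ be the symmetrization of $\widetilde{h^\Gamma}$ (its average over all permutations of the variables). Then $$G_\Gamma(\omega)=\sum f^\Gamma(v_1,\dots,v_n),$$ the sum being over all ordered $n$-tuples of pairwise distinct points of $\omega$. A Poisson point process with intensity measure $\lambda\,dx$ is a random finite set $\omega$ such that the number of points in any Borel set $A$ is Poisson with mean $\lambda|A|$, with independence over disjoint sets. *)

(* Defs.v *)
From HB Require Import structures.
From mathcomp Require Import all_boot all_order all_algebra perm finmap.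
From mathcomp Require Import all_classical all_reals all_analysis.

Set Implicit Arguments.
Unset Strict Implicit.
Unset Printing Implicit Defensive.

Import Order.TTheory GRing.Theory Num.Theory.
Import numFieldNormedType.Exports.

Local Open Scope ring_scope.

(* Every element of [V] is a vertex; the empty simplex is not listed. *)
Record simplicial_complex (V : finType) := SimplicialComplex {
  faces :> {set {set V}};
  faces_neq0 : forall A, A \in faces -> A != finset.set0;
  faces_vertex : forall x : V, [set x]%SET \in faces;
  faces_sub : forall A B : {set V},
    A \in faces -> B \subset A -> B != finset.set0 -> B \in faces
}.

Definition edge (V : finType) (Gamma : simplicial_complex V) : rel V :=
  fun x y => (x != y) && ([set x; y]%SET \in faces Gamma).

Definition connected_complex (V : finType) (Gamma : simplicial_complex V) :=
  forall x y : V, connect (edge Gamma) x y.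

Local Open Scope classical_set_scope.

Section lebesgue_tuple.
Context {R : realType}.
Local Notation borelR := (measurableTypeR R).

Definition cons_tuple n (p : borelR * n.-tuple borelR) : n.+1.-tuple borelR :=
  [the n.+1.-tuple borelR of p.1 :: p.2].

Lemma measurable_cons_tuple n :
  measurable_fun [set: borelR * n.-tuple borelR] (@cons_tuple n).
Proof. exact: measurable_cons. Qed.

Section step.
Variables (n : nat).
Variable mu : {sigma_finite_measure set n.-tuple borelR -> \bar R}.

Definition cons_measure : set (n.+1.-tuple borelR) -> \bar R :=
  pushforward (@lebesgue_measure R \x mu)%E (@cons_tuple n).

Let cons_measure0 : cons_measure set0 = 0%E.
Proof. by rewrite /cons_measure /pushforward preimage_set0 measure0. Qed.

Let cons_measure_ge0 A : (0 <= cons_measure A)%E.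
Proof. by rewrite /cons_measure /pushforward; exact: measure_ge0. Qed.

Let cons_measure_sigma_additive : semi_sigma_additive cons_measure.
Proof.
move=> F mF tF mUF; rewrite /cons_measure /pushforward preimage_bigcup.
have mpre A : measurable A -> measurable (@cons_tuple n @^-1` A).
  move=> mA; rewrite -[X in measurable X]setTI.
  exact: (@measurable_cons_tuple n measurableT A mA).
apply: (@measure_semi_sigma_additive _ _ _ (@lebesgue_measure R \x mu)%E).
- by move=> k; exact: mpre.
- apply/trivIsetP => /= i j _ _ ij; rewrite -preimage_setI.
  by move/trivIsetP : tF => /(_ _ _ _ _ ij) ->//; rewrite preimage_set0.
- by rewrite -preimage_bigcup; exact: mpre.
Qed.

HB.instance Definition _ := isMeasure.Build _ _ _ cons_measure
  cons_measure0 cons_measure_ge0 cons_measure_sigma_additive.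

Let cons_measure_sigma_finite : sigma_finite setT cons_measure.
Proof.
have /sigma_finiteP[F [FT ndF Foo]] := sigma_finiteT (@lebesgue_measure R).
have /sigma_finiteP[G [GT ndG Goo]] := sigma_finiteT mu.
pose g (t : n.+1.-tuple borelR) : (borelR * n.-tuple borelR)%type :=
  (tnth t ord0, [tuple of behead t]).
have mg : measurable_fun setT g.
  apply/measurable_fun_pair => /=.
    exact: measurable_tnth.
  exact: measurable_behead.
have gK p : g (cons_tuple p) = p.
  by case: p => x t; rewrite /g/=; congr pair; exact/val_inj.
exists (fun k => g @^-1` (F k `*` G k)).
  rewrite -preimage_bigcup -[LHS](preimage_setT g); congr preimage.
  rewrite -setXTT FT GT predeqE => -[x y]; split.
    move=> [/= [k _ Fkx] [l _ Gly]]; exists (maxn k l) => //; split.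
      by move: x Fkx; exact/subsetPset/ndF/leq_maxl.
    by move: y Gly; exact/subsetPset/ndG/leq_maxr.
  by move=> [k _ []/= ? ?]; split; exists k.
move=> k; have [mF Fk] := Foo k; have [mG Gk] := Goo k; split.
  rewrite -[X in measurable X]setTI; apply: mg => //; exact: measurableX.
rewrite /cons_measure /pushforward (_ : _ @^-1` _ = F k `*` G k); last first.
  rewrite -comp_preimage (_ : g \o @cons_tuple n = id)//; exact/funext.
by rewrite product_measure1E// lte_mul_pinfty// ge0_fin_numE.
Qed.

HB.instance Definition _ := Measure_isSigmaFinite.Build _ _ _ cons_measure
  cons_measure_sigma_finite.

End step.

(* [d]-fold product of the Lebesgue measure of [R] *)
Fixpoint lebesgue_tuple (d : nat) :
    {sigma_finite_measure set d.-tuple borelR -> \bar R} :=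
  if d is d'.+1 return
    {sigma_finite_measure set d.-tuple borelR -> \bar R}
  then cons_measure (lebesgue_tuple d')
  else dirac ([tuple] : 0.-tuple borelR).

Lemma lebesgue_tuple_box d (A : 'I_d -> set borelR) :
  (forall i, measurable (A i)) ->
  lebesgue_tuple d [set x | forall i, A i (tnth x i)] =
  (\prod_(i < d) lebesgue_measure (A i))%E.
Proof.
elim: d A => [|d IHd] A mA.
  rewrite big_ord0 /= diracE mem_set//=; by case.
rewrite big_ord_recl /= /cons_measure /pushforward -IHd; last by [].
pose B : set (d.-tuple borelR) :=
  [set x | forall i, A (lift ord0 i) (tnth x i)].
have mB : measurable B.
  rewrite (_ : B = \bigcap_(i in [set: 'I_d])
      ((@tnth d borelR)^~ i @^-1` A (lift ord0 i))).
    apply: fin_bigcap_measurable => // i _.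
    by rewrite -[X in measurable X]setTI; exact: measurable_tnth.
  by apply/seteqP; split => x /= Bx i; [move=> _|]; exact: Bx.
rewrite (_ : _ @^-1` _ = A ord0 `*` B) ?product_measure1E//.
apply/seteqP; split => -[x t] /= H.
  by split=> [|i]; [exact: (H ord0)|have := H (lift ord0 i); rewrite tnthS].
move=> i; case: (unliftP ord0 i) => [j|] ->; last exact: H.1.
by rewrite tnthS; exact: H.2.
Qed.

End lebesgue_tuple.

Section torus.
Context {R : realType}.
Local Notation borelR := (measurableTypeR R).
Variables (d : nat) (a : R).
Local Notation point := (d.-tuple borelR).

(* The torus [R^d / a Z^d], through its fundamental domain [[0, a)^d]; its
   Borel sets are the measurable subsets of this domain. *)
Definition torus : set point :=
  [set x | forall i, 0 <= (tnth x i : R) < a].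

(* The norm of a row vector is the sup norm. *)
Definition torus_dist (x y : point) : R :=
  inf [set `|\row_(i < d) ((tnth x i : R) - tnth y i + (m i)%:~R * a)|
      | m in [set: 'I_d -> int]].

Definition nb_points (A : set point) (omega : {fset point}) : nat :=
  #|` [fset x in omega | x \in A]%fset|.

Record poisson_process (dT : measure_display) (T : measurableType dT)
    (P : probability T R) (lambda : R) (omega : T -> {fset point}) : Prop :=
  PoissonProcess {
  poisson_process_torus : forall t x, x \in omega t -> torus x;
  measurable_nb_points : forall A, measurable A -> A `<=` torus ->
    measurable_fun [set: T] (fun t => nb_points A (omega t));
  (* the second argument of [poisson_prob] is a dummy *)
  poisson_nb_points : forall A, measurable A -> A `<=` torus ->
    pushforward P (fun t => nb_points A (omega t)) =
    poisson_prob (lambda * fine (lebesgue_tuple d A)) 0%N;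
  independent_nb_points : forall (m : nat) (A : 'I_m -> set point),
    (forall i, measurable (A i)) -> (forall i, A i `<=` torus) ->
    trivIset [set: 'I_m] A ->
    forall k : 'I_m -> nat,
      P (\bigcap_(i in [set: 'I_m]) [set t | nb_points (A i) (omega t) = k i]) =
      (\prod_(i < m) P [set t | nb_points (A i) (omega t) = k i])%E
}.

Section occurrences.
Variables (eps : R) (n : nat) (Gamma : simplicial_complex 'I_n).
Implicit Type v : 'I_n -> point.

Definition edges_appear v : R :=
  \prod_(ij : 'I_n * 'I_n | edge Gamma ij.1 ij.2)
    (torus_dist (v ij.1) (v ij.2) < 2 * eps)%R%:R.

(* The condition is invariant under the scaling by [1 / c_Gamma], hence may be
   written with the unnormalized product. *)
Definition nb_symmetries : nat :=
  #|[set s : 'S_n | `[< forall v, (forall i, torus (v i)) ->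
                         edges_appear v = edges_appear (v \o s) >]]%SET|.

Definition kernel_raw v : R := edges_appear v / nb_symmetries%:R.

Definition kernel_sym v : R :=
  (n`!)%:R^-1 * \sum_(s : 'S_n) kernel_raw (v \o s).

Definition nb_occurrences (omega : {fset point}) : R :=
  \sum_(v : {ffun 'I_n -> omega} | injectiveb v)
    kernel_sym (fun i => val (v i)).

End occurrences.

End torus.

Section wasserstein.
Context {R : realType}.
Local Notation borelR := (measurableTypeR R).

(* Kantorovich-Rubinstein form: supremum over the 1-Lipschitz test functions.
   Laws are passed as set functions, as in [pushforward] and [integral]. *)
Definition wasserstein (mu nu : set borelR -> \bar R) : \bar R :=
  ereal_sup [set `| \int[mu]_x (f x)%:E - \int[nu]_x (f x)%:E |%E
            | f in [set f : R -> R | 1.-lipschitz f]].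

Definition standardize (dT : measure_display) (T : measurableType dT)
    (P : probability T R) (X : T -> R) : T -> borelR :=
  fun t => (X t - fine 'E_P[X]%E) / Num.sqrt (fine 'V_P[X]%E).

End wasserstein.

(* Main.v *)
(* Translation invariance makes the expected number of occurrences of Gamma
   through a given point of the torus independent of this point. Hence, to
   leading order, G - E G is (n E G / mu) (N - mu), where N is the number of
   points of omega and mu = lambda a^d its mean. Quantitatively, with
   standardized versions X of G and Y of N,
   E (X - Y)^2 = 2 (1 - corr(G, N)) = O(1 / lambda), which follows from
   E (G N) = E G (mu + n) and E G^2 <= (E G)^2 + (n E G)^2 / mu + O(lambda^(2n-2)).
   These moments are computed on a grid: cells contain independent Poisson
   numbers of points, expanding the square of the count according to the set of
   shared cells gives the three terms, and refining the grid recovers G by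
   dominated convergence. Finally Y, a standardized Poisson variable, is at
   Wasserstein distance O(mu^(-1/2)) from the normal law: this is Stein's method
   with the identity E (N h(N)) = mu E (h(N + 1)). *)
Require Import Defs.
From mathcomp Require Import all_boot all_order all_algebra perm finmap.
From mathcomp Require Import all_classical all_reals all_analysis.
From mathcomp Require Import measurable_realfun.
From mathcomp Require Import ring lra zify.

Set Implicit Arguments.
Unset Strict Implicit.
Unset Printing Implicit Defensive.

Import Order.TTheory GRing.Theory Num.Theory.
Import numFieldNormedType.Exports.

Local Open Scope classical_set_scope.
Local Open Scope ring_scope.

(** * Stein's equation *)

(** A Poisson process is given only through its counts in Borel sets, whereas G sums over tuples of
    points: this is what imposes the grid. Cells turn such sums into polynomials in independent
    counts, and as only patterns of distinct cells are kept, no count is raised to a power within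
    one pattern. For each configuration the grid counts stay below G and are eventually equal to it.
    The limit therefore yields the measurability of G along with its moments, a power of N + 1 being
    the dominating function. All grid bounds depend on the mesh only through mu and the grid mean.

    The covariance of G and N is exactly n E G, so Cauchy-Schwarz bounds Var G below by (n E G)^2 /
    mu, the very leading term of the upper bound; positivity and order of the variance come for
    free. The error O(lambda^(2n-2)) is relatively small because E G is at least of order lambda^n,
    which is read off one fixed grid carrying a pattern of positive weight.

    In Stein's method the increment of Y when N grows by one is mu^(-1/2), so the Taylor remainder
    O(1 / mu), multiplied by mu^(1/2), gives the rate. *)

Section stein.
Context {R : realType}.
Implicit Types (F Phi : R -> R) (x y C : R).

Definition gauss (x : R) : R := expR (- (x ^+ 2 / 2)).

Lemma gauss_gt0 x : 0 < gauss x. Proof. exact: expR_gt0. Qed.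

Lemma is_derive_gauss x : is_derive x 1 gauss (- x * gauss x).
Proof.
rewrite /gauss.
have h : is_derive x 1 (fun y : R => - (y ^+ 2 / 2)) (- x).
  apply: is_derive_eq.
  by rewrite ?scaler0 ?add0r ?addr0 /GRing.scale/=; field.
have := @is_derive1_comp R expR (fun y : R => - (y ^+ 2 / 2)) x _ _ (is_derive_expR _) h.
by rewrite mulrC.
Qed.

Lemma cvg_gauss : gauss n%:R @[n --> \oo] --> (0 : R).
Proof.
apply: (@squeeze_cvgr _ _ _ _ (cst 0) (fun n => 2 * n.+1%:R^-1)).
- near=> n; rewrite ltW ?gauss_gt0//= /gauss expRN.
  have n1 : 1 <= n%:R :> R by rewrite ler1n; near: n; exists 1%N.
  have -> : 2 * n.+1%:R^-1 = (n.+1%:R / 2)^-1 :> R by rewrite invfM invrK mulrC.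
  rewrite lef_pV2 ?posrE ?expR_gt0 ?divr_gt0//.
  have := expR_ge1Dx (n%:R ^+ 2 / 2 : R).
  rewrite -(natr1 n); move=> /(le_trans _); apply.
  nra.
- exact: cvg_cst.
- rewrite -[0](mulr0 2); apply: cvgM; first exact: cvg_cst.
  exact: cvg_harmonic.
Unshelve. all: by end_near. Qed.

(** Comparison principle: tail integrals against [gauss] are bounded below by comparing derivatives
    of functions that vanish at infinity, so that no integral over a half-line has to be
    estimated. *)
Lemma le0_of_nondecreasing_cvg0 (D dD : R -> R) x :
  (forall y, x <= y -> is_derive y 1 D (dD y)) ->
  (forall y, x <= y -> 0 <= dD y) ->
  D n%:R @[n --> \oo] --> 0 -> D x <= 0.
Proof.
move=> dDE dD0 D0.
rewrite -(cvg_lim _ D0)//; apply: limr_ge; first by apply/cvg_ex; exists 0.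
near=> n.
have xn : x <= n%:R.
  by near: n; exact: nbhs_infty_ger.
have [||c cxn E] := @MVT_segment R D dD x n%:R xn.
- by move=> z zx; apply: dDE; move: zx; rewrite in_itv/= => /andP[/ltW].
- apply: derivable_within_continuous => z; rewrite in_itv/= => /andP[xz _].
  by have [] := dDE z xz.
- move: cxn; rewrite in_itv/= => /andP[xc _].
  by rewrite -subr_ge0 E mulr_ge0 ?subr_ge0 ?dD0.
Unshelve. all: by end_near. Qed.

Lemma cvg_gauss_bounded (u : R -> R) B :
  (\forall n \near \oo, `|u n%:R| <= B) ->
  gauss n%:R * u n%:R @[n --> \oo] --> (0 : R).
Proof.
move=> uB; apply/norm_cvg0P.
apply: (@squeeze_cvgr _ _ _ _ (cst 0) (fun n => gauss n%:R * B)).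
- near=> n; rewrite normr_ge0/= normrM gtr0_norm ?gauss_gt0//.
  by rewrite ler_pM2l ?gauss_gt0//; near: n.
- exact: cvg_cst.
- by rewrite -[0](mul0r B); apply: cvgMl; exact: cvg_gauss.
Unshelve. all: by end_near. Qed.

(** Here [Phi x] is minus the integral of [F * gauss] over [[x, +oo[], and [- F y <= C + y]. The
    part [y] integrates exactly to [gauss x]; the part [C] is a Mills ratio estimate, whose decay in
    [x] is dropped at the end. *)
Lemma stein_upper F Phi C :
  (forall x y, `|F x - F y| <= `|x - y|) -> `|F 0| <= C ->
  (forall x, is_derive x 1 Phi (F x * gauss x)) ->
  Phi n%:R @[n --> \oo] --> 0 ->
  forall x, 0 <= x -> Phi x <= (1 + 2 * C) * gauss x.
Proof.
move=> LF F0 dPhi Phi0 x x0.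
have C0 : 0 <= C := le_trans (normr_ge0 _) F0.
(* As both sides vanish at infinity, it is enough that Phi - gauss * u is
   nondecreasing; u is chosen for that, and is at most 1 + 2 C. *)
pose u y : R := 1 + 2 * C / (1 + y).
have D0 : Phi x - gauss x * u x <= 0.
  pose dD y := F y * gauss y -
     (gauss y * (- (2 * C) / (1 + y) ^+ 2) + u y * (- y * gauss y)).
  apply: (@le0_of_nondecreasing_cvg0 (fun y => Phi y - gauss y * u y) dD).
  - move=> y xy.
    have y1 : 1 + y != 0 by rewrite gt_eqF// ltr_wpDr// (le_trans x0).
    have du : is_derive y 1 u (- (2 * C) / (1 + y) ^+ 2).
      have h : is_derive y 1 (fun y : R => 1 + y) 1.
        rewrite (_ : (fun y : R => 1 + y) = cst 1 \+ id)//.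
        by apply: is_derive_eq; rewrite add0r.
      have h' := @is_deriveV R (fun y : R => 1 + y) y 1 1 y1 h.
      apply: is_derive_eq.
      by rewrite /GRing.scale/=; field.
    have := is_derive_gauss y => dg.
    apply: is_derive_eq.
    by rewrite /dD /GRing.scale/=.
  - move=> y xy; have y0 : 0 <= y := le_trans x0 xy.
    rewrite /dD.
    have -> : F y * gauss y - (gauss y * (- (2 * C) / (1 + y) ^+ 2) +
       u y * (- y * gauss y)) =
       gauss y * (F y + (2 * C) / (1 + y) ^+ 2 + u y * y) by ring.
    apply: mulr_ge0; first by rewrite ltW// gauss_gt0.
    have Fy : - (C + y) <= F y.
      have := LF y 0; rewrite subr0 (ger0_norm y0) => H.
      move: H F0; rewrite !ler_norml => /andP[H1 _] /andP[H2 _]; lra.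
    rewrite /u.
    have -> : F y + (2 * C) / (1 + y) ^+ 2 + (1 + 2 * C / (1 + y)) * y =
       F y + (C + y) + C * (y ^+ 2 + 1) / (1 + y) ^+ 2 by field; lra.
    rewrite addr_ge0//; first lra.
    by rewrite divr_ge0 ?sqr_ge0// mulr_ge0// addr_ge0 ?sqr_ge0.
  - rewrite -[0](subr0 0); apply: cvgB => //.
    apply: (@cvg_gauss_bounded u (1 + 2 * C)); apply: nearW => n.
    have n0 : 0 <= n%:R :> R by [].
    rewrite /u ger0_norm; last by rewrite addr_ge0// divr_ge0 ?mulr_ge0 ?addr_ge0.
    by rewrite lerD2l ler_pdivrMr ?ltr_wpDr// ler_peMr ?mulr_ge0// lerDl.
apply: (@le_trans _ _ (gauss x * u x)); first by rewrite -subr_le0.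
rewrite mulrC ler_pM2r ?gauss_gt0// /u lerD2l ler_pdivrMr ?ltr_wpDr//.
by rewrite ler_peMr ?mulr_ge0// lerDl.
Qed.

(** For [g = Phi / gauss] the left side is [gauss x] times [g' x]. The bound is of order [1 / x],
    the decay that makes [x * g' x] bounded; estimating the two terms separately would lose the
    cancellation between them. *)
Lemma stein_deriv_upper F Phi x :
  (forall x y, `|F x - F y| <= `|x - y|) ->
  (forall x, is_derive x 1 Phi (F x * gauss x)) ->
  Phi n%:R @[n --> \oo] --> 0 -> 1 <= x ->
  x * Phi x + F x * gauss x <= (`|F x| + x) / x ^+ 2 * gauss x.
Proof.
move=> LF dPhi Phi0 x1; have x0 : 0 < x by lra.
set K := `|F x| + x; have K0 : 0 <= K by rewrite addr_ge0// ltW.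
(* In the comparison below x is frozen in x Phi(y) + F(x) gauss(y), so that only
   F y - F x enters its derivative; moreover u x = 1 / x ^ 2. *)
pose u y : R := 1 - x / y + (y ^+ 2)^-1.
have D0 : x * Phi x + F x * gauss x - gauss x * (K * u x) <= 0.
  pose dD y := x * (F y * gauss y) + F x * (- y * gauss y) -
     (gauss y * (K * (x / y ^+ 2 - 2 * y / (y ^+ 2) ^+ 2)) + (K * u y) * (- y * gauss y)).
  apply: (@le0_of_nondecreasing_cvg0 (fun y => x * Phi y + F x * gauss y - gauss y * (K * u y)) dD).
  - move=> y xy; have y0 : 0 < y by lra.
    have y1 : y != 0 by rewrite gt_eqF.
    have y2 : y ^+ 2 != 0 by rewrite expf_neq0.
    have h1 : is_derive y 1 (fun y : R => y^-1) (- (y ^+ 2)^-1).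
      have := @is_deriveV R id y 1 1 y1 _.
      by rewrite /GRing.scale/= mulr1; apply; exact: is_derive_id.
    have h3 : is_derive y 1 (fun y : R => y ^+ 2) (2 * y).
      by apply: is_derive_eq; rewrite /GRing.scale/=; ring.
    have h2 : is_derive y 1 (fun y : R => (y ^+ 2)^-1) (- (2 * y) / (y ^+ 2) ^+ 2).
      have := @is_deriveV R (fun y : R => y ^+ 2) y _ 1 y2 h3.
      by rewrite /GRing.scale/=; congr is_derive; ring.
    have dg := is_derive_gauss y.
    apply: is_derive_eq.
    rewrite /dD /u /GRing.scale/=; ring.
  - move=> y xy; have y0 : 0 < y by lra.
    have y1 : y != 0 by rewrite gt_eqF.
    have -> : dD y = gauss y * (x * (F y - F x) - (y - x) * F x + K * (y - x)
        + K * ((y - x) / y ^+ 2 + 2 * y / (y ^+ 2) ^+ 2)).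
      by rewrite /dD /u; field.
    apply: mulr_ge0; first by rewrite ltW// gauss_gt0.
    apply: addr_ge0; last first.
      rewrite mulr_ge0// addr_ge0// divr_ge0 ?sqr_ge0 ?subr_ge0//.
      by rewrite mulr_ge0// ltW.
    have H := LF y x; rewrite (ger0_norm (_ : 0 <= y - x)) ?subr_ge0// in H.
    have : - (y - x) <= F y - F x by move: H; rewrite ler_norml => /andP[].
    (* The Lipschitz bound costs [x * (y - x)] and the term in [F x] at most [|F x| * (y - x)];
       together this is [K * (y - x)]. *)
    rewrite /K; have := ler_norm (F x); nra.
  - have cu : gauss n%:R * (K * u n%:R) @[n --> \oo] --> (0 : R).
      apply: (@cvg_gauss_bounded (fun y => K * u y) (K * 2)).
      near=> n; have xn : x <= n%:R by near: n; exact: nbhs_infty_ger.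
      have n0 : (0 : R) < n%:R by lra.
      rewrite normrM (ger0_norm K0) ler_wpM2l// /u.
      have h : 0 <= x / n%:R <= 1.
        apply/andP; split; first by rewrite divr_ge0// ltW.
        by rewrite ler_pdivrMr// mul1r.
      have h' : 0 <= (n%:R ^+ 2 : R)^-1 <= 1.
        have n1 : (1 : R) <= n%:R by lra.
        by rewrite invr_ge0 sqr_ge0 invf_le1 ?exprn_gt0// exprn_ege1.
      by rewrite ler_norml; lra.
    rewrite -[0](subr0 0); apply: cvgB => //.
    rewrite -[0](addr0 0); apply: cvgD.
      by rewrite -(mulr0 x); apply: cvgMr.
    by rewrite -(mulr0 (F x)); apply: cvgMr; exact: cvg_gauss.
have ux : u x = (x ^+ 2)^-1 by rewrite /u divff ?gt_eqF// subrr add0r.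
by rewrite -subr_le0 [_ / _ * _]mulrC -ux.
Unshelve. all: by end_near. Qed.

(** The bounds above are one-sided; applied to [- F] and [- Phi] as well, they control absolute
    values. *)
Lemma stein_half F Phi C :
  (forall x y, `|F x - F y| <= `|x - y|) -> `|F 0| <= C ->
  (forall x, is_derive x 1 Phi (F x * gauss x)) ->
  Phi n%:R @[n --> \oo] --> 0 ->
  forall x, 0 <= x ->
    `|Phi x| <= (2 + 3 * C) * gauss x /\
    `|x * (x * Phi x + F x * gauss x)| <= (2 + 3 * C) * gauss x.
Proof.
move=> LF F0 dPhi Phi0 x x0.
have C0 : 0 <= C := le_trans (normr_ge0 _) F0.
have LNF u v : `|- F u - - F v| <= `|u - v| by rewrite -opprD normrN.
have NF0 : `|- F 0| <= C by rewrite normrN.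
have dNPhi y : is_derive y 1 (fun y => - Phi y) (- F y * gauss y).
  by have := dPhi y => ?; apply: is_derive_eq; rewrite mulNr.
have NPhi0 : - Phi n%:R @[n --> \oo] --> 0 by rewrite -[0]oppr0; exact: cvgN.
have gx := gauss_gt0 x.
have H1 : `|Phi x| <= (1 + 2 * C) * gauss x.
  rewrite ler_norml lerNl; apply/andP; split; last exact: (stein_upper LF).
  exact: (stein_upper LNF NF0 dNPhi).
split; first by apply: (le_trans H1); rewrite ler_pM2r//; lra.
have Fx : `|F x| <= x + C.
  have := LF x 0; rewrite subr0 (ger0_norm x0) => H.
  have := ler_normD (F x - F 0) (F 0); rewrite subrK; lra.
rewrite normrM (ger0_norm x0).
(* Up to 1 the factor [x] is harmless and the two terms are bounded separately, by [1 + 2 * C] and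
   [1 + C]; beyond 1 the [1 / x] decay compensates it. *)
have [x1|/ltW x1] := leP x 1.
  have H2 : `|x * Phi x + F x * gauss x| <= (2 + 3 * C) * gauss x.
    apply: (le_trans (ler_normD _ _)).
    rewrite !normrM (ger0_norm x0) (gtr0_norm gx).
    have : x * `|Phi x| <= (1 + 2 * C) * gauss x by apply: le_trans H1; rewrite ler_piMl.
    have : `|F x| * gauss x <= (1 + C) * gauss x by rewrite ler_pM2r//; lra.
    lra.
  by apply: le_trans H2; rewrite ler_piMl.
have x00 : 0 < x by lra.
have H2 : `|x * Phi x + F x * gauss x| <= (`|F x| + x) / x ^+ 2 * gauss x.
  rewrite ler_norml lerNl; apply/andP; split; last exact: (stein_deriv_upper LF).
  have := stein_deriv_upper LNF dNPhi NPhi0 x1.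
  by rewrite normrN mulrN mulNr -opprD.
apply: (@le_trans _ _ (x * ((`|F x| + x) / x ^+ 2 * gauss x))).
  by rewrite ler_pM2l.
rewrite mulrA ler_pM2r//.
have -> : x * ((`|F x| + x) / x ^+ 2) = (`|F x| + x) / x by field; rewrite gt_eqF.
by rewrite ler_pdivrMr//; nra.
Qed.

(** Negative arguments follow by reflection: [Phi (- y)] is an antiderivative of
    [- F (- y) * gauss y], and [- F (- y)] satisfies the same hypotheses as [F]. *)
Lemma stein_bounds F Phi C :
  (forall x y, `|F x - F y| <= `|x - y|) -> `|F 0| <= C ->
  (forall x, is_derive x 1 Phi (F x * gauss x)) ->
  Phi n%:R @[n --> \oo] --> 0 -> Phi (- n%:R) @[n --> \oo] --> 0 ->
  forall x,
    `|Phi x| <= (2 + 3 * C) * gauss x /\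
    `|x * (x * Phi x + F x * gauss x)| <= (2 + 3 * C) * gauss x.
Proof.
move=> LF F0 dPhi Phi0 PhiN0 x.
have [x0|/ltW x0] := leP 0 x; first exact: (stein_half LF).
have gN y : gauss (- y) = gauss y by rewrite /gauss sqrrN.
have := @stein_half (fun y => - F (- y)) (fun y => Phi (- y)) C _ _ _ _ (- x).
rewrite opprK gN oppr_ge0; case => //.
- by move=> u v; rewrite -opprD normrN (le_trans (LF _ _))// -opprD normrN.
- by rewrite normrN oppr0.
- move=> y.
  have h : is_derive y 1 (fun y : R => - y) (- 1) by apply: is_derive_eq.
  have := @is_derive1_comp R Phi (fun y : R => - y) y _ _ (dPhi _) h.
  by rewrite gN mulrN1 mulNr.
- by rewrite !mulNr -opprD mulrN opprK.
Qed.

(** As [F] need not be differentiable, a Lipschitz constant of [g'] takes the place of a bound on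
    [g'']: twice [2 + 3 * C] for the term [x * g x], plus 1 for [F]. *)
Lemma stein_regularity F Phi C :
  (forall x y, `|F x - F y| <= `|x - y|) -> `|F 0| <= C ->
  (forall x, is_derive x 1 Phi (F x * gauss x)) ->
  Phi n%:R @[n --> \oo] --> 0 -> Phi (- n%:R) @[n --> \oo] --> 0 ->
  exists g : R -> R, (forall x, `|g x| <= 2 + 3 * C) /\
    forall x h, `|g (x + h) - g x - h * (x * g x + F x)| <= (5 + 6 * C) * h ^+ 2.
Proof.
move=> LF F0 dPhi Phi0 PhiN0.
have C0 : 0 <= C := le_trans (normr_ge0 _) F0.
pose g x := Phi x / gauss x.
(* dg, the derivative of g, is Lipschitz since (x g)' = g + x dg is bounded. *)
pose dg x := x * g x + F x.
have gn0 x : gauss x != 0 by rewrite gt_eqF ?gauss_gt0.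
have H := stein_bounds LF F0 dPhi Phi0 PhiN0.
have gB x : `|g x| <= 2 + 3 * C.
  rewrite /g normrM normfV (gtr0_norm (gauss_gt0 x)) ler_pdivrMr ?gauss_gt0//.
  by have [] := H x.
have xdgB x : `|x * dg x| <= 2 + 3 * C.
  have -> : x * dg x = x * (x * Phi x + F x * gauss x) / gauss x.
    by rewrite /dg /g; field.
  rewrite normrM normfV (gtr0_norm (gauss_gt0 x)) ler_pdivrMr ?gauss_gt0//.
  by have [] := H x.
have Dg x : is_derive x 1 g (dg x).
  have d1 := is_derive_gauss x; have d2 := dPhi x.
  have d3 := is_deriveV (gn0 x) d1.
  by apply: is_derive_eq; rewrite /dg /g /GRing.scale/=; field.
have Dxg x : is_derive x 1 (fun x => x * g x) (g x + x * dg x).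
  have := Dg x => ?; apply: is_derive_eq; rewrite /GRing.scale/=; ring.
have mvt (f df : R -> R) x y : (forall x, is_derive x 1 f (df x)) ->
    exists2 z, `|z - x| <= `|y - x| & f y - f x = df z * (y - x).
  move=> Df.
  have cf (i : interval R) : {within [set` i], continuous f}.
    by apply: derivable_within_continuous => z _; have [] := Df z.
  have [xy|/ltW yx] := leP x y.
    have [|z] := MVT_segment xy (fun z _ => Df z); first exact: cf.
    rewrite in_itv/= => /andP[xz zy] E; exists z => //.
    by rewrite !ger0_norm ?subr_ge0// lerD2r.
  have [|z] := MVT_segment yx (fun z _ => Df z); first exact: cf.
  rewrite in_itv/= => /andP[xz zy] E; exists z.
    by rewrite !ler0_norm ?subr_le0// lerN2 lerD2r.
  by rewrite -opprB E -mulrN opprB.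
have Ldg x y : `|dg y - dg x| <= (5 + 6 * C) * `|y - x|.
  have [z _ E] := mvt _ _ x y Dxg.
  have -> : dg y - dg x = (y * g y - x * g x) + (F y - F x) by rewrite /dg; ring.
  apply: (le_trans (ler_normD _ _)); rewrite E normrM.
  have h1 : `|g z + z * dg z| <= 4 + 6 * C.
    apply: (le_trans (ler_normD _ _)); have := gB z; have := xdgB z; lra.
  have h2 := ler_wpM2r (normr_ge0 (y - x)) h1.
  have := LF y x; lra.
exists g; split => // x h.
have [z zh E] := mvt _ _ x (x + h) Dg.
rewrite E (addrC x) addrK in zh *.
have -> : dg z * h - h * (x * g x + F x) = h * (dg z - dg x) by rewrite /dg; ring.
rewrite normrM.
have h1 : `|dg z - dg x| <= (5 + 6 * C) * `|h|.
  by apply: (le_trans (Ldg _ _)); rewrite ler_wpM2l//; lra.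
have := ler_wpM2l (normr_ge0 h) h1.
by rewrite -[h ^+ 2]real_normK ?num_real// expr2 [leRHS]mulrCA.
Qed.

End stein.

(** Measurability of [f] is part of what is obtained, not assumed: the number of occurrences becomes
    a random variable in this way, as a limit of grid counts. *)
Lemma cvg_Rintegral d (T : measurableType d) (R : realType)
    (mu : {measure set T -> \bar R}) (f_ : nat -> T -> R) (f g : T -> R) :
  (forall n, measurable_fun setT (f_ n)) ->
  (forall t, f_ n t @[n --> \oo] --> f t) ->
  mu.-integrable setT (EFin \o g) -> (forall n t, `|f_ n t| <= g t) ->
  mu.-integrable setT (EFin \o f) /\
  \int[mu]_t f_ n t @[n --> \oo] --> \int[mu]_t f t.
Proof.
move=> mf_ f_f ig fg.
have mf : measurable_fun setT f.
  by apply: (measurable_fun_cvg mf_) => t _; exact: f_f.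
have [|||||if_ _ cv] := @dominated_convergence _ _ _ mu setT measurableT
    (fun n t => (f_ n t)%:E) (fun t => (f t)%:E) (fun t => (g t)%:E).
- by move=> n; exact/measurable_EFinP.
- exact/measurable_EFinP.
- by apply: aeW => t _; apply: cvg_EFin; [exact: nearW|exact: f_f].
- exact: ig.
- by apply: aeW => t n _; rewrite lee_fin.
split => //; apply: fine_cvg; rewrite fineK//.
exact: integrable_fin_num if_.
Qed.

(** * Integrals against the normal law *)

Section normal.
Context {R : realType}.
Local Notation mu := (@lebesgue_measure R).
Local Notation normal := (@normal_prob R 0 1).

(** The Radon-Nikodym derivative of the normal law and the explicit density have the same integral
    over every measurable set, hence agree almost everywhere. *)
Lemma ge0_integral_normal (f : measurableTypeR R -> \bar R) : measurable_fun setT f ->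
  (forall x, 0 <= f x)%E ->
  (\int[normal]_x f x = \int[mu]_x (f x * (normal_pdf 0 1 x)%:E))%E.
Proof.
move=> mf f0.
have dom := normal_prob_dominates (0 : R) 1.
rewrite -(Radon_Nikodym_SigmaFinite.change_of_variables dom)//.
have mg := Radon_Nikodym_SigmaFinite.f_integrable dom.
apply: ae_eq_integral => //.
- by apply: emeasurable_funM => //; exact: measurable_int mg.
- by apply: emeasurable_funM => //; apply/measurable_EFinP; exact: measurable_normal_pdf.
- apply: ae_eqe_mul2l.
  apply: integral_ae_eq => //.
  + by apply/measurable_EFinP; exact: measurable_normal_pdf.
  + by move=> E _ mE; rewrite -Radon_Nikodym_SigmaFinite.f_integral.
Qed.

Lemma integral_normal (f : measurableTypeR R -> \bar R) : measurable_fun setT f ->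
  (\int[normal]_x f x = \int[mu]_x (f x * (normal_pdf 0 1 x)%:E))%E.
Proof.
move=> mf; rewrite [LHS]integralE [RHS]integralE.
rewrite !ge0_integral_normal//; [|exact: measurable_funeneg|exact: measurable_funepos].
have p0 x : (0 <= (normal_pdf 0 1 x)%:E :> \bar R)%E by rewrite lee_fin normal_pdf_ge0.
congr (_ - _)%E; apply: eq_integral => x _; rewrite ?funeposE ?funenegE.
  by rewrite maxe_pMl// mul0e.
by rewrite maxe_pMl// mul0e mulNe.
Qed.

Lemma normal_pdf_gauss (x : R) : normal_pdf 0 1 x = normal_peak 1 * gauss x.
Proof.
by rewrite normal_pdfE ?oner_neq0// /normal_fun /gauss subr0 expr1n mulNr.
Qed.

Lemma measurable_gauss : measurable_fun [set: R] (@gauss R).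
Proof.
have -> : @gauss R = (fun x => (normal_peak 1)^-1 * normal_pdf 0 1 x).
  apply/funext => x; rewrite normal_pdf_gauss mulKf//.
  by rewrite gt_eqF// normal_peak_gt0// oner_neq0.
by apply: measurable_funM => //; exact: measurable_normal_pdf.
Qed.

(** The right side is, up to a constant, the normal density of standard deviation 2, so this gives
    integrability of linear growth against [gauss]. Of the exponent [x ^ 2 / 2], the share
    [3 / 8 * x ^ 2] absorbs the linear factor. *)
Let linear_gauss_le (x : R) :
  (1 + `|x|) * gauss x <= 2 * expR (- (x ^+ 2 / (2 ^+ 2 *+ 2))).
Proof.
have -> : 2 ^+ 2 *+ 2 = 8 :> R by rewrite -mulr_natr; ring.
rewrite /gauss.
have -> : - (x ^+ 2 / 2) = - (x ^+ 2 * (3 / 8)) - x ^+ 2 / 8 by field.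
rewrite expRD mulrA ler_pM2r ?expR_gt0// expRN ler_pdivrMr ?expR_gt0//.
have := expR_ge1Dx (x ^+ 2 * (3 / 8)).
have : `|x| <= 1 + x ^+ 2 / 4.
  by have := sqr_ge0 (`|x| - 2); rewrite sqrrB real_normK ?num_real//; lra.
have := sqr_ge0 x; lra.
Qed.

Lemma integrable_linear_gauss :
  mu.-integrable setT (fun x => ((1 + `|x|) * gauss x)%:E).
Proof.
pose c : R := 2 / normal_peak 2.
have p0 : 0 < normal_peak (2 : R) by rewrite normal_peak_gt0// pnatr_eq0.
have cp : 0 <= c by rewrite divr_ge0// ltW.
have ig : mu.-integrable setT (fun x => (c%:E * (normal_pdf 0 2 x)%:E)%E).
  by apply: integrableZl => //; exact: integrable_normal_pdf.
apply: (le_integrable measurableT _ _ ig).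
- apply/measurable_EFinP; apply: measurable_funM; last exact: measurable_gauss.
  by apply: measurable_funD => //; exact: measurableT_comp.
- move=> x _; rewrite abseM !abse_EFin -EFinM lee_fin.
  rewrite (ger0_norm cp) (ger0_norm (normal_pdf_ge0 _ _ _)).
  rewrite ger0_norm; last by rewrite mulr_ge0 ?addr_ge0// ltW// gauss_gt0.
  rewrite normal_pdfE ?pnatr_eq0// /c -mulrA mulKf ?gt_eqF//.
  by rewrite /normal_fun subr0 mulNr; exact: linear_gauss_le.
Qed.

Lemma lipschitz1_continuous (f : R -> R) :
  (forall x y, `|f x - f y| <= `|x - y|) -> continuous f.
Proof.
move=> Lf x; apply/cvgrPdist_le => e e0; near=> y.
by apply: (le_trans (Lf _ _)); near: y; apply: cvgr_dist_le.
Unshelve. all: by end_near. Qed.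

Lemma lipschitz1_measurable (f : R -> R) :
  (forall x y, `|f x - f y| <= `|x - y|) -> measurable_fun [set: R] f.
Proof. by move=> Lf; apply: continuous_measurable_fun; exact: lipschitz1_continuous. Qed.

Lemma lipschitz1_le (f : R -> R) (x : R) :
  (forall x y, `|f x - f y| <= `|x - y|) -> `|f x| <= (1 + `|f 0|) * (1 + `|x|).
Proof.
move=> Lf; have := Lf x 0; rewrite subr0 => h.
have := ler_normD (f x - f 0) (f 0); rewrite subrK.
have := normr_ge0 (f 0); have := normr_ge0 x; nra.
Qed.

Lemma integrable_lipschitz1_gauss (f : R -> R) :
  (forall x y, `|f x - f y| <= `|x - y|) ->
  mu.-integrable setT (fun x => (f x * gauss x)%:E).
Proof.
move=> Lf; have ig := integrableZl measurableT (1 + `|f 0|) integrable_linear_gauss.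
apply: (le_integrable measurableT _ _ ig).
- apply/measurable_EFinP; apply: measurable_funM; last exact: measurable_gauss.
  exact: lipschitz1_measurable.
- move=> x _; rewrite -EFinM !abse_EFin lee_fin !normrM.
  rewrite !(ger0_norm (addr_ge0 ler01 (normr_ge0 _))) mulrA ler_wpM2r//.
  exact: lipschitz1_le.
Qed.

Lemma integrable_lipschitz1_normal (f : R -> R) :
  (forall x y, `|f x - f y| <= `|x - y|) ->
  normal.-integrable setT (EFin \o f).
Proof.
move=> Lf; apply/integrableP; split.
  by apply/measurable_EFinP; exact: lipschitz1_measurable.
rewrite integral_normal; last first.
  apply: measurableT_comp => //; apply/measurable_EFinP; exact: lipschitz1_measurable.
have := integrableZl measurableT (normal_peak 1) (integrable_lipschitz1_gauss Lf).
move=> /integrableP[_]; apply: le_lt_trans; rewrite le_eqVlt; apply/orP; left; apply/eqP.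
apply: eq_integral => x _.
rewrite /= normal_pdf_gauss; congr EFin.
rewrite !normrM (ger0_norm (normal_peak_ge0 1)) (gtr0_norm (gauss_gt0 _)).
by rewrite mulrCA.
Qed.

Lemma fine_integral_normal (f : R -> R) :
  (forall x y, `|f x - f y| <= `|x - y|) ->
  (\int[normal]_x (f x)%:E = (normal_peak 1 * \int[mu]_x (f x * gauss x))%:E)%E.
Proof.
move=> Lf; rewrite integral_normal; last first.
  by apply/measurable_EFinP; exact: lipschitz1_measurable.
have ig := integrable_lipschitz1_gauss Lf.
rewrite EFinM /Rintegral fineK; last exact: integrable_fin_num ig.
rewrite -integralZl//; apply: eq_integral => x _.
by rewrite normal_pdf_gauss -!EFinM mulrCA.
Qed.

Lemma cvg_Rintegral_dominated (h l : R -> R) (A : nat -> set R) :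
  mu.-integrable setT (EFin \o h) ->
  (forall n, measurable (A n : set (measurableTypeR R))) ->
  (forall x, (h \_ (A n)) x @[n --> \oo] --> l x) ->
  \int[mu]_(x in A n) h x @[n --> \oo] --> \int[mu]_x l x.
Proof.
move=> ih mA hl.
have mh : measurable_fun [set: R] h.
  by apply/measurable_EFinP; exact: measurable_int ih.
have mhA n : measurable_fun [set: R] (h \_ (A n)).
  apply: (measurable_restrictT _ _).1; first exact: mA.
  exact: measurable_funTS.
under eq_fun do rewrite Rintegral_mkcond.
apply: (@cvg_Rintegral _ _ _ mu (fun n => h \_ (A n)) l (fun x => `|h x|) mhA hl
  (integrable_abse ih) _).2.
move=> n x; rewrite patchE /=.
by case: ifPn => // _; rewrite normr0.
Qed.

(** This is E (1 + |Z|) for a standard normal Z. It bounds |f 0 - E f(Z)| for all 1-Lipschitz [f] at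
    once, so the Stein bounds are uniform in the test function. *)
Definition stein_const : R := normal_peak 1 * \int[mu]_x ((1 + `|x|) * gauss x).

Lemma stein_const_ge0 : 0 <= stein_const.
Proof.
apply: mulr_ge0; first exact: normal_peak_ge0.
by apply: Rintegral_ge0 => x _; rewrite mulr_ge0 ?addr_ge0// ltW// gauss_gt0.
Qed.

(* A second-order Taylor estimate stands for the equation
   g' x - x g x = f x - E f(Z), Z normal, and a bound on g''. *)
Lemma stein_equation (f : R -> R) :
  (forall x y, `|f x - f y| <= `|x - y|) ->
  exists g : R -> R, (forall x, `|g x| <= 2 + 3 * stein_const) /\
    forall x h, `|g (x + h) - g x -
        h * (x * g x + (f x - fine (\int[normal]_x (f x)%:E)))| <=
      (5 + 6 * stein_const) * h ^+ 2.
Proof.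
move=> Lf; rewrite fine_integral_normal//=.
set m := normal_peak 1 * _.
pose F x := f x - m.
have LF x y : `|F x - F y| <= `|x - y|.
  by rewrite /F opprB addrA addrNK.
have p0 := normal_peak_ge0 (1 : R).
have i1 : mu.-integrable setT (fun x => (gauss x)%:E).
  have := @integrable_lipschitz1_gauss (cst 1).
  by under eq_fun do rewrite mul1r; apply => x y; rewrite subrr normr0.
have I1 : (normal_peak 1 * \int[mu]_x gauss x = 1 :> R).
  rewrite -RintegralZl//; under eq_Rintegral do rewrite -normal_pdf_gauss.
  by rewrite /Rintegral integral_normal_pdf.
have iG := integrable_lipschitz1_gauss LF.
have if_ := integrable_lipschitz1_gauss Lf.
have F0 : `|F 0| <= stein_const.
  have -> : F 0 = normal_peak 1 * \int[mu]_x ((f 0 - f x) * gauss x).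
    under eq_Rintegral do rewrite mulrBl.
    rewrite RintegralB//; last exact: (integrableZl measurableT (f 0) i1).
    by rewrite RintegralZl// /F /m mulrBr mulrCA I1 mulr1.
  have L0 x y : `|(f 0 - f x) - (f 0 - f y)| <= `|x - y|.
    by rewrite opprB addrC addrA subrK distrC (le_trans (Lf _ _)).
  have i0 := integrable_lipschitz1_gauss L0.
  rewrite normrM (ger0_norm p0) ler_wpM2l//.
  apply: le_trans (le_normr_Rintegral _ i0) _ => //.
  apply: le_Rintegral => //; [exact: integrable_abse i0|exact: integrable_linear_gauss|].
  move=> x _; rewrite normrM (gtr0_norm (gauss_gt0 _)) ler_wpM2r//; first exact/ltW/gauss_gt0.
  by apply: (le_trans (Lf _ _)); rewrite sub0r normrN lerDr.
have IG0 : \int[mu]_x (F x * gauss x) = 0 :> R.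
  under eq_Rintegral do rewrite mulrBl.
  rewrite RintegralB//; last exact: (integrableZl measurableT m i1).
  by rewrite RintegralZl// /m mulrAC I1 mul1r subrr.
(* The antiderivative of [F * gauss] that vanishes at minus infinity; centring [F] ([IG0]) makes it
   vanish at plus infinity too, as [stein_regularity] requires. *)
pose Phi (x : R) : R := \int[mu]_(t in [set` `]-oo, x]]) (F t * gauss t).
have dPhi (x : R) : is_derive x 1 Phi (F x * gauss x).
  have [||||d1 d2] := @continuous_FTC1 R (fun t => F t * gauss t) (BInfty _ true) x (x + 1).
  - by rewrite ltrDl.
  - exact: integrableS iG.
  - by rewrite ltNyr.
  - apply: cvgM; first exact: lipschitz1_continuous.
    have /derivable1_diffP/differentiable_continuous : derivable gauss x 1.
      by have [] := is_derive_gauss x.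
    by [].
  by apply: DeriveDef; [exact: d1|rewrite -derive1E d2].
have Phiy : Phi n%:R @[n --> \oo] --> 0.
  rewrite -[0]IG0; apply: (@cvg_Rintegral_dominated (fun t => F t * gauss t)) => //.
  - move=> x; apply: cvg_near_cst; near=> n.
    rewrite patchE mem_set//= in_itv/=; near: n; exact: nbhs_infty_ger.
have PhiNy : Phi (- n%:R) @[n --> \oo] --> 0.
  have -> : 0 = \int[mu]_x (cst 0 x) :> R.
    by rewrite Rintegral_cst// mul0r.
  apply: (@cvg_Rintegral_dominated (fun t => F t * gauss t)) => //.
  - move=> x; apply: cvg_near_cst; near=> n.
    rewrite patchE memNset//= in_itv/= lerNr; apply/negP; rewrite -ltNge.
    near: n; exact: nbhs_infty_gtr.
exact: (stein_regularity LF F0 dPhi Phiy PhiNy).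
Unshelve. all: by end_near. Qed.

End normal.

(** * Poisson variables *)

Section poisson_rv.
Context d (T : measurableType d) (R : realType) (P : probability T R).
Implicit Types (N : T -> nat) (r : R).

Lemma ge0_integral_nat_rv N (H : T -> \bar R) :
  measurable_fun setT N -> measurable_fun setT H -> (forall t, 0 <= H t)%E ->
  (\int[P]_t H t = \sum_(k <oo) \int[P]_(t in N @^-1` [set k]) H t)%E.
Proof.
move=> mN mH H0.
have mNk k : measurable (N @^-1` [set k]).
  by rewrite -[X in measurable X]setTI; exact: mN.
rewrite -ge0_integral_bigcup//.
- by rewrite -preimage_bigcup bigcup_imset1 image_id preimage_setT.
- by rewrite -preimage_bigcup bigcup_imset1 image_id preimage_setT.
- apply/trivIsetP => i j _ _ ij; rewrite -preimage_setI.
  by rewrite set1I; case: ifPn => [/set_mem/= ji|_]; [rewrite ji eqxx in ij|rewrite preimage_set0].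
Qed.

Lemma integral_prob_cst (c : R) : (\int[P]_t c%:E = c%:E)%E.
Proof.
rewrite integral_cst// -[RHS]mule1; congr (_ * _)%E; exact: probability_setT.
Qed.

Lemma Rintegral_prob_cst (c : R) : \int[P]_t c = c.
Proof. by rewrite /Rintegral integral_prob_cst. Qed.

Lemma le_norm_Rintegral_cst (X : T -> R) (c : R) : measurable_fun setT X ->
  (forall t, `|X t| <= c) -> `|\int[P]_t X t| <= c.
Proof.
move=> mX Xc.
have ic : P.-integrable setT (fun=> c%:E) by exact: finite_measure_integrable_cst.
have iX : P.-integrable setT (fun t => (X t)%:E).
  apply: (le_integrable measurableT _ _ ic); first exact/measurable_EFinP.
  by move=> t _; rewrite lee_fin (le_trans (Xc t))// ler_norm.
apply: (le_trans (le_normr_Rintegral measurableT iX)).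
rewrite -[leRHS]Rintegral_prob_cst; apply: le_Rintegral => //.
exact: integrable_abse iX.
Qed.

Definition poisson_rv r N :=
  measurable_fun setT N /\ forall k, P (N @^-1` [set k]) = (poisson_pmf r k)%:E.

Lemma poisson_rv_ge0_integral r N (h : nat -> R) :
  poisson_rv r N -> (forall k, 0 <= h k) ->
  (\int[P]_t (h (N t))%:E = \sum_(k <oo) (h k * poisson_pmf r k)%:E)%E.
Proof.
move=> [mN PN] h0; rewrite (@ge0_integral_nat_rv N)//; last 2 first.
- by apply/measurable_EFinP; exact: measurableT_comp mN.
- by move=> t; rewrite lee_fin.
apply: eq_eseriesr => k _.
have mNk : measurable (N @^-1` [set k]).
  by rewrite -[X in measurable X]setTI; exact: mN.
rewrite -[RHS](_ : (h k)%:E * P (N @^-1` [set k]) = _)%E; last by rewrite PN EFinM.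
by rewrite -integral_cst//; apply: eq_integral => t /set_mem /= ->.
Qed.

(** The weights satisfy [k.+1 * p(k.+1) = r * p(k)] and the term [k = 0] vanishes. Stated for
    nonnegative [h] with extended values, it can serve to prove that moments are finite. *)
Lemma poisson_rv_chen r N (h : nat -> R) : 0 < r ->
  poisson_rv r N -> (forall k, 0 <= h k) ->
  (\int[P]_t ((N t)%:R * h (N t))%:E = r%:E * \int[P]_t (h (N t).+1)%:E)%E.
Proof.
move=> r0 pN h0.
rewrite (poisson_rv_ge0_integral (h := fun k => k%:R * h k) pN); last first.
  by move=> k; exact: mulr_ge0.
rewrite (poisson_rv_ge0_integral (h := fun k => h k.+1) pN)//.
rewrite -nneseriesZl; last first.
  by move=> k _; rewrite lee_fin mulr_ge0// poisson_pmf_ge0.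
rewrite nneseries_recl//; last first.
  by move=> k _; rewrite lee_fin !mulr_ge0// poisson_pmf_ge0.
rewrite !mul0r add0e -[in LHS](add0n 1%N) -nneseries_addn; last first.
  by move=> k; rewrite lee_fin !mulr_ge0// poisson_pmf_ge0.
apply: eq_eseriesr => k _; rewrite -EFinM; congr EFin.
rewrite !addn1 /poisson_pmf r0 factS natrM invfM exprS.
by field; rewrite !pnatr_eq0 /= -lt0n fact_gt0 /= nat1r pnatr_eq0.
Qed.

(** Induction by (N + 1)^(j+1) = N (N + 1)^j + (N + 1)^j: the identity above turns the first term
    into r E (N + 2)^j, at most r 2^j E (N + 1)^j. Using N + 1 instead of N makes [k.+2 <= 2 * k.+1]
    true at [k = 0] as well. *)
Lemma poisson_rv_integrable_exp r N j : 0 < r -> poisson_rv r N ->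
  P.-integrable setT (fun t => ((N t).+1%:R ^+ j)%:E).
Proof.
move=> r0 pN; have mN := pN.1.
have mh (h : nat -> R) : measurable_fun setT (fun t => (h (N t))%:E).
  by apply/measurable_EFinP; exact: measurableT_comp mN.
elim: j => [|j IH].
  under eq_fun do rewrite expr0; exact: finite_measure_integrable_cst.
apply/integrableP; split; first exact: (mh (fun k => k.+1%:R ^+ j.+1)).
under eq_integral.
  move=> t _; rewrite gee0_abs ?lee_fin ?exprn_ge0// exprS -[X in X * _]natr1 mulrDl mul1r EFinD; over.
rewrite /= ge0_integralD//=; last 2 first.
- exact: (mh (fun k => k%:R * k.+1%:R ^+ j)).
- exact: (mh (fun k => k.+1%:R ^+ j)).
have fin : (\int[P]_t ((N t).+1%:R ^+ j)%:E < +oo)%E.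
  have /integrableP[_] := IH; under eq_integral do rewrite gee0_abs ?lee_fin ?exprn_ge0//.
  by [].
apply: lte_add_pinfty => //.
rewrite (poisson_rv_chen (h := fun k => k.+1%:R ^+ j) r0 pN); last first.
  by move=> k; rewrite exprn_ge0.
apply: lte_mul_pinfty => //; first by rewrite lee_fin ltW.
apply: le_lt_trans (_ : \int[P]_t ((2 ^+ j)%:E * ((N t).+1%:R ^+ j)%:E) < _)%E.
  apply: ge0_le_integral => //.
  - exact: (mh (fun k => k.+2%:R ^+ j)).
  - exact: (mh (fun k => (2 ^+ j) * k.+1%:R ^+ j)).
  - move=> t _; rewrite -EFinM lee_fin -exprMn lerXn2r ?nnegrE//.
    by rewrite -natrM ler_nat; lia.
rewrite ge0_integralZl//; last exact: (mh (fun k => k.+1%:R ^+ j)).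
by apply: lte_mul_pinfty => //; rewrite lee_fin exprn_ge0.
Qed.

Lemma poisson_rv_integrable r N j (h : nat -> R) C : 0 < r -> poisson_rv r N ->
  (forall k, `|h k| <= C * k.+1%:R ^+ j) ->
  P.-integrable setT (fun t => (h (N t))%:E).
Proof.
move=> r0 pN hC.
have iC := integrableZl measurableT C (poisson_rv_integrable_exp j r0 pN).
apply: (le_integrable measurableT _ _ iC).
  by apply/measurable_EFinP; exact: measurableT_comp pN.1.
move=> t _; rewrite -EFinM lee_fin.
by apply: (le_trans (hC _)); rewrite ler_norm.
Qed.

(** The nonnegative case applies to [h + B]; the identity for the constant [B] is then
    subtracted. *)
Lemma poisson_rv_Rchen r N (h : nat -> R) (B : R) : 0 < r -> poisson_rv r N ->
  (forall k, `|h k| <= B) ->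
  \int[P]_t ((N t)%:R * h (N t)) = r * \int[P]_t h (N t).+1.
Proof.
move=> r0 pN hB.
have B0 : 0 <= B := le_trans (normr_ge0 _) (hB 0%N).
have hp k : 0 <= h k + B by have := hB k; rewrite ler_norml => /andP[]; lra.
have h2 k : h k + B <= 2 * B by have := hB k; rewrite ler_norml => /andP[]; lra.
have nk k : (k%:R : R) <= k.+1%:R by rewrite ler_nat.
have iB : P.-integrable setT (fun t => ((N t)%:R * B)%:E).
  apply: (@poisson_rv_integrable _ _ 1 (fun k => k%:R * B) B r0 pN) => k.
  by rewrite ger0_norm ?mulr_ge0// expr1 mulrC ler_wpM2l.
have ih : P.-integrable setT (fun t => ((N t)%:R * h (N t))%:E).
  apply: (@poisson_rv_integrable _ _ 1 (fun k => k%:R * h k) B r0 pN) => k.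
  rewrite normrM expr1 mulrC (ger0_norm (ler0n _ _)).
  by apply: ler_pM.
have ih1 : P.-integrable setT (fun t => (h (N t).+1)%:E).
  apply: (@poisson_rv_integrable _ _ 0 (fun k => h k.+1) B r0 pN) => k.
  by rewrite expr0 mulr1.
have iB1 : P.-integrable setT (fun t => B%:E) by exact: finite_measure_integrable_cst.
have E1 := poisson_rv_chen (h := fun k => h k + B) r0 pN hp.
have E2 := poisson_rv_chen (h := fun k => B) r0 pN (fun=> B0).
have {}E1 : \int[P]_t ((N t)%:R * h (N t)) + \int[P]_t ((N t)%:R * B) =
    r * (\int[P]_t h (N t).+1 + \int[P]_t B).
  rewrite -!RintegralD//; under eq_Rintegral do rewrite -mulrDr.
  rewrite /Rintegral E1 fineM//.
  exact: (integrable_fin_num measurableT (integrableD measurableT ih1 iB1)).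
have {}E2 : \int[P]_t ((N t)%:R * B) = r * \int[P]_t B.
  rewrite /Rintegral E2 fineM//; exact: integrable_fin_num iB1.
by move: E1; rewrite mulrDr E2 => /addIr.
Qed.

Lemma poisson_rv_normal r N (f : R -> R) : 0 < r -> poisson_rv r N ->
  (forall x y, `|f x - f y| <= `|x - y|) ->
  P.-integrable setT (fun t => (f (((N t)%:R - r) / Num.sqrt r))%:E) /\
  `|\int[P]_t f (((N t)%:R - r) / Num.sqrt r) -
    fine (\int[normal_prob 0 1]_x (f x)%:E)| <=
    (5 + 6 * @stein_const R) / Num.sqrt r.
Proof.
move=> r0 pN Lf.
have [g [gB gD]] := stein_equation Lf.
set m := fine _ in gD *; set s := Num.sqrt r; set B := 2 + 3 * _ in gB.
set B' := 5 + _ in gD *.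
have s0 : 0 < s by rewrite sqrtr_gt0.
have sn0 : s != 0 by rewrite gt_eqF.
have rs : r = s ^+ 2 by rewrite sqr_sqrtr// ltW.
pose y (k : nat) : R := (k%:R - r) / s.
pose h k := g (y k).
have yS k : y k.+1 = y k + s^-1 by rewrite /y -natr1; field.
pose D k := g (y k + s^-1) - g (y k) - s^-1 * (y k * g (y k) + (f (y k) - m)).
have DB k : `|D k| <= B' / r.
  by apply: (le_trans (gD _ _)); rewrite exprVn rs.
have B'0 : 0 <= B' by rewrite /B'; have := @stein_const_ge0 R; lra.
(* By the Chen identity the first two terms have opposite expectations, so only the remainder
   [s * D k] survives, and it is at most [s * (B' / r) = B' / s]. *)
have fE k : f (y k) - m = s * h k.+1 - s^-1 * (k%:R * h k) - s * D k.
  have kE : k%:R = s * y k + s ^+ 2 by rewrite -rs /y; field.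
  by rewrite /D /h yS kE; field.
have iD : P.-integrable setT (fun t => (s * D (N t))%:E).
  apply: (@poisson_rv_integrable _ _ 0 (fun k => s * D k) (s * (B' / r)) r0 pN) => k.
  by rewrite expr0 mulr1 normrM (gtr0_norm s0) ler_wpM2l// ltW.
have ih : P.-integrable setT (fun t => (h (N t).+1)%:E).
  apply: (@poisson_rv_integrable _ _ 0 (fun k => h k.+1) B r0 pN) => k.
  by rewrite expr0 mulr1 /h.
have iNh : P.-integrable setT (fun t => ((N t)%:R * h (N t))%:E).
  apply: (@poisson_rv_integrable _ _ 1 (fun k => k%:R * h k) B r0 pN) => k.
  rewrite normrM expr1 mulrC (ger0_norm (ler0n _ _)).
  by apply: ler_pM; rewrite ?ler_nat// /h.
have i1 : P.-integrable setT (fun t => (s * h (N t).+1)%:E) by exact: (integrableZl measurableT s ih).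
have i2 : P.-integrable setT (fun t => (s^-1 * ((N t)%:R * h (N t)))%:E).
  exact: (integrableZl measurableT s^-1 iNh).
have im : P.-integrable setT (fun t => m%:E) by exact: finite_measure_integrable_cst.
have i12 : P.-integrable setT (fun t => (s * h (N t).+1 - s^-1 * ((N t)%:R * h (N t)))%:E).
  exact: (integrableB measurableT i1 i2).
have iF : P.-integrable setT (fun t => (f (y (N t)) - m)%:E).
  under eq_fun do rewrite fE; exact: (integrableB measurableT i12 iD).
have if_ : P.-integrable setT (fun t => (f (y (N t)))%:E).
  under eq_fun do rewrite -[f _](subrK m); exact: (integrableD measurableT iF im).
split; first exact: if_.
have -> : \int[P]_t f (y (N t)) - m = \int[P]_t (f (y (N t)) - m).
  by rewrite RintegralB// Rintegral_prob_cst.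
under eq_Rintegral do rewrite fE.
rewrite RintegralB// RintegralB// !RintegralZl//; last first.
  by apply: (@poisson_rv_integrable _ _ 0 D (B' / r) r0 pN) => k; rewrite expr0 mulr1.
have hB k : `|h k| <= B by rewrite /h.
rewrite (poisson_rv_Rchen r0 pN hB).
have -> : s * \int[P]_t h (N t).+1 - s^-1 * (r * \int[P]_t h (N t).+1) = 0.
  by rewrite rs; field.
rewrite sub0r normrN normrM (gtr0_norm s0).
have -> : B' / s = s * (B' / r) by rewrite rs; field.
rewrite ler_wpM2l//; first exact: ltW.
apply: le_norm_Rintegral_cst => //; exact: measurableT_comp pN.1.
Qed.

End poisson_rv.

(** * Expectations of products of independent counts *)

Section independence.
Context d (T : measurableType d) (R : realType) (P : probability T R).

Lemma integral_prod_independent m (X : 'I_m -> T -> nat) :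
  (forall i, measurable_fun setT (X i)) ->
  (forall k : 'I_m -> nat,
    P (\bigcap_(i in [set: 'I_m]) [set t | X i t = k i]) =
    (\prod_(i < m) P [set t | X i t = k i])%E) ->
  forall (h : 'I_m -> nat -> R) (e : 'I_m -> R),
  (forall i k, 0 <= h i k) ->
  (forall i, \int[P]_t (h i (X i t))%:E = (e i)%:E)%E ->
  (\int[P]_t (\prod_i h i (X i t))%:E = (\prod_i e i)%:E)%E.
Proof.
move=> mX indX.
have mXk i k : measurable [set t | X i t = k].
  by rewrite -[X in measurable X]setTI; exact: (mX i measurableT [set k]).
(* Induction on the number n of factors which are not indicators of a point. *)
suff H n : forall (h : 'I_m -> nat -> R) (e : 'I_m -> R),
    (forall i k, 0 <= h i k) ->
    (forall i : 'I_m, (n <= i)%N -> exists k, h i = fun j => (j == k)%:R) ->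
    (forall i, \int[P]_t (h i (X i t))%:E = (e i)%:E)%E ->
    (\int[P]_t (\prod_i h i (X i t))%:E = (\prod_i e i)%:E)%E.
  by move=> h e h0; apply: (H m) => // i; rewrite leqNgt ltn_ord.
have eqXE i k t : (X i t == k)%:R = \1_[set t | X i t = k] t :> R.
  rewrite indicE; congr (_%:R); congr nat_of_bool.
  by apply/eqP/idP => [?|/set_mem//]; apply/mem_set.
elim: n => [|n IH] h e h0 hn hE.
  have {}hn (i : 'I_m) : {k | h i = fun j => (j == k)%:R} by apply: cid; exact: hn.
  pose k i := sval (hn i).
  have hk i j : h i j = (j == k i)%:R by rewrite (svalP (hn i)).
  have ek i : e i = fine (P [set t | X i t = k i]).
    rewrite -[e i]/(fine (e i)%:E) -hE; congr fine.
    under eq_integral do rewrite hk eqXE.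
    by rewrite integral_indic// setIT.
  transitivity (P (\bigcap_(i in [set: 'I_m]) [set t | X i t = k i])).
    rewrite -[in RHS](setIT (\bigcap_(i in _) _)) -integral_indic//; last first.
      by apply: fin_bigcap_measurable => //.
    apply: eq_integral => t _; congr EFin.
    rewrite indicE; have [/set_mem tk|tk] := boolP (t \in _).
      by rewrite big1// => i _; rewrite hk (tk i)// eqxx.
    have [i ti] : exists i, X i t != k i.
      apply/existsP; apply: contraNT tk => /existsPn tk.
      by apply/mem_set => i _; apply/eqP; rewrite -[_ == _]negbK; exact: tk.
    by rewrite (bigD1 i)//= hk (negbTE ti) mul0r.
  rewrite indX -prodEFin.
  apply: eq_bigr => i _; rewrite ek fineK//.
  exact: fin_num_measure.
have [nm|mn] := ltnP n m; last first.
  by apply: IH => // i /(leq_trans mn); rewrite leqNgt ltn_ord.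
(* In [h' k] the factor [i0] is replaced by the indicator of the value [k], to which the induction
   hypothesis applies. Weighting by [h i0 k] and summing over [k] restores the original factor. *)
pose i0 := Ordinal nm.
pose h' k i j : R := if i == i0 then (j == k)%:R else h i j.
pose e' k i : R := if i == i0 then fine (P [set t | X i0 t = k]) else e i.
have IHk k : (\int[P]_t (\prod_i h' k i (X i t))%:E = (\prod_i e' k i)%:E)%E.
  apply: IH.
  - by move=> i j; rewrite /h'; case: ifP.
  - move=> i ni; rewrite /h'; case: eqVneq => [_|ii0]; first by exists k.
    apply: hn; rewrite ltn_neqAle ni andbT; apply: contra_neq ii0 => ni'.
    exact: val_inj.
  - move=> i; rewrite /h' /e'; case: eqVneq => [->|_]; last exact: hE.
    under eq_integral do rewrite eqXE.
    rewrite integral_indic// setIT fineK//; exact: fin_num_measure.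
have mh (g : nat -> R) i : measurable_fun setT (fun t => g (X i t)).
  exact: measurableT_comp (mX i).
rewrite (ge0_integral_nat_rv P (mX i0)); last 2 first.
- by apply/measurable_EFinP; apply: measurable_prod => i _; exact: (mh (h i) i).
- by move=> t; rewrite lee_fin prodr_ge0.
pose E := \prod_(i | i != i0) e i.
have E0 : 0 <= E.
  apply: prodr_ge0 => i _; rewrite -lee_fin -hE; apply: integral_ge0 => t _.
  by rewrite lee_fin.
transitivity (\sum_(k <oo) (E%:E * (h i0 k * fine (P [set t | X i0 t = k]))%:E))%E.
  apply: eq_eseriesr => k _.
  transitivity (\int[P]_t ((h i0 k)%:E * (\prod_i h' k i (X i t))%:E))%E.
    rewrite integral_mkcond; apply: eq_integral => t _.
    rewrite patchE (bigD1 i0)//= [in RHS](bigD1 i0)//= /h' eqxx.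
    case: ifPn => [/set_mem/= ->|/negP tk].
      rewrite eqxx mul1r -EFinM; congr EFin; congr (_ * _).
      by apply: eq_bigr => i /negbTE ->.
    case: eqP => [/= Xk|_]; last by rewrite mul0r mule0.
    by exfalso; apply: tk; rewrite inE.
  rewrite ge0_integralZl//; last 3 first.
  - apply/measurable_EFinP; apply: measurable_prod => i _; exact: (mh (h' k i) i).
  - by move=> t _; rewrite lee_fin prodr_ge0// => i _; rewrite /h'; case: ifP.
  - by rewrite lee_fin.
  rewrite IHk -EFinM (bigD1 i0)//= /e' eqxx -EFinM; congr EFin.
  rewrite [in LHS](eq_bigr e) /E; first by ring.
  by move=> i /negbTE ->.
rewrite nneseriesZl; last first.
  by move=> k _; rewrite lee_fin mulr_ge0// fine_ge0.
rewrite (bigD1 i0)//= -/E mulrC EFinM; congr (_ * _)%E.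
rewrite -hE (ge0_integral_nat_rv P (mX i0)); last 2 first.
- by apply/measurable_EFinP; exact: (mh (h i0) i0).
- by move=> t; rewrite lee_fin.
apply: eq_eseriesr => k _.
rewrite EFinM fineK; last exact: fin_num_measure.
rewrite -integral_cst//; apply: eq_integral => t /set_mem /= ->//.
Qed.

End independence.

(** * Moments of pattern counts *)

Lemma prod_codom (R : comNzRingType) (I K : finType) (k : I -> K) (F : K -> R) :
  injective k -> \prod_(x in codom k) F x = \prod_i F (k i).
Proof.
move=> kinj; rewrite -big_uniq/=; last by rewrite map_inj_uniq// enum_uniq.
by rewrite big_image.
Qed.

Lemma prod1D_sum (R : comNzRingType) (I : finType) (u : R) (b : I -> R) :
  \prod_i (1 + u * b i) =
  \sum_(A : {set I}) u ^+ #|A| * \prod_(i in A) b i.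
Proof.
under eq_bigr do rewrite addrC.
rewrite bigA_distr; apply: eq_big => [A|A _]; first by rewrite inE.
rewrite -prodr_const -big_split/= -big_mkcond/=.
by apply: eq_bigr => i.
Qed.

(** With [x] the mean of a cell, [m] the number of cells and [s] the number of shared cells, all
    powers recombine into powers of the total mean [x * m]: the mesh disappears from the error
    term. *)
Lemma expr_excess (R : fieldType) (x y m : R) n s : x != 0 -> (s <= n)%N ->
  x ^+ (n + n) * x^-1 ^+ s * (m ^+ n * (y * m ^+ (n - s))) =
  y * (x * m) ^+ (n + (n - s)).
Proof.
move=> x0 sn; have -> : (n + n = n + (n - s) + s)%N by lia.
rewrite [in LHS]exprD exprVn mulfK ?expf_neq0// exprMn [in RHS]exprD.
by rewrite !exprD; ring.
Qed.

Section pattern_sums.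
Context (R : realType) (K : finType) (n : nat) (F : {ffun 'I_n -> K} -> R).
Hypothesis F0 : forall k, 0 <= F k.
Hypothesis F1 : forall k, F k <= 1.
Hypothesis F_hom : forall i x y,
  \sum_(k : {ffun 'I_n -> K} | k i == x) F k = \sum_(k : {ffun 'I_n -> K} | k i == y) F k.

Let S := \sum_k F k.
Let M : R := #|K|%:R.

Lemma pattern_marginal i x : M * \sum_(k : {ffun 'I_n -> K} | k i == x) F k = S.
Proof.
rewrite /S [RHS](partition_big (fun k : {ffun 'I_n -> K} => k i) xpredT)//=.
under [RHS]eq_bigr do rewrite (F_hom i _ x).
by rewrite sumr_const -mulr_natl.
Qed.

(* The weight of the pairs (k, l) in which l visits k i for all i in A: the
   coefficient of a power of the inverse intensity in the second moment. *)
Definition overlap (A : {set 'I_n}) : R :=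
  \sum_k \sum_l F k * F l * \prod_(i in A) (k i \in codom (l : {ffun 'I_n -> K}))%:R.

Lemma overlap0 : overlap finset.set0 = S ^+ 2.
Proof.
rewrite /overlap expr2 /S mulr_suml; apply: eq_bigr => k _; rewrite mulr_sumr.
by apply: eq_bigr => l _; rewrite big_set0 mulr1.
Qed.

(** Union bound over the [j] with [l j = k i]: there are [n] of them, and by homogeneity prescribing
    one cell of [l] costs exactly a factor [M]. This sharp constant is what makes the variance match
    its Cauchy-Schwarz lower bound. *)
Lemma overlap1 i : M * overlap [set i]%SET <= n%:R * S ^+ 2.
Proof.
rewrite /overlap.
apply: (@le_trans _ _ (M * \sum_k \sum_l F k * F l * \sum_j (l j == k i)%:R)).
  apply: ler_wpM2l => //; apply: ler_sum => k _; apply: ler_sum => l _.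
  rewrite big_set1; apply: ler_wpM2l; first exact: mulr_ge0.
  have [/codomP[j ->]|_] := boolP (k i \in codom l); last exact: sumr_ge0.
  by rewrite (bigD1 j)//= eqxx lerDl sumr_ge0.
rewrite le_eqVlt; apply/orP; left; apply/eqP.
transitivity (M * \sum_k F k * \sum_j \sum_(l : {ffun 'I_n -> K} | l j == k i) F l).
  congr (_ * _); apply: eq_bigr => k _.
  under eq_bigr do rewrite -mulrA mulr_sumr.
  rewrite -mulr_sumr exchange_big; congr (_ * _).
  apply: eq_bigr => j _; rewrite [RHS]big_mkcond; apply: eq_bigr => l _.
  by case: ifP => _; rewrite ?mulr1 ?mulr0.
rewrite mulr_sumr.
under eq_bigr => k _.
  rewrite mulrCA mulr_sumr.
  under eq_bigr => j _ do rewrite pattern_marginal.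
  rewrite sumr_const card_ord -mulr_natl; over.
by rewrite -mulr_suml -/S expr2; ring.
Qed.

(** Crude count with [F] bounded by 1: for each [l], an index in [A] has at most [n] choices and any
    other index has [M]. *)
Lemma overlap_le (A : {set 'I_n}) :
  overlap A <= M ^+ n * (n%:R ^+ #|A| * M ^+ (n - #|A|)).
Proof.
rewrite /overlap exchange_big/=.
apply: (@le_trans _ _ (\sum_(l : {ffun 'I_n -> K}) (n%:R ^+ #|A| * M ^+ (n - #|A|)))); last first.
  rewrite sumr_const card_ffun card_ord -[leLHS]mulr_natl.
  by rewrite natrX.
apply: ler_sum => l _.
apply: (@le_trans _ _ (\sum_(k : {ffun 'I_n -> K}) \prod_i (if i \in A then (k i \in codom l)%:R else 1))).
  apply: ler_sum => k _; rewrite -big_mkcond/= ler_piMl//.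
    by apply: prodr_ge0.
  by rewrite mulr_ile1.
rewrite -(bigA_distr_bigA (fun i x => if i \in A then (x \in codom l)%:R else 1 : R)).
rewrite (bigID (mem A))/=.
have -> : \prod_(i in A) \sum_x (if i \in A then (x \in codom l)%:R else 1 : R) =
    (#|codom l|)%:R ^+ #|A|.
  rewrite -prodr_const; apply: eq_bigr => i ->.
  rewrite -natr_sum -[in RHS]sum1_card [in RHS]big_mkcond.
  by congr _%:R.
have -> : \prod_(i | i \notin A) \sum_x (if i \in A then (x \in codom l)%:R else 1 : R) =
    M ^+ (n - #|A|).
  have -> : (n - #|A|)%N = #|~: A|%SET by rewrite [RHS]cardsCs finset.setCK card_ord.
  rewrite -prodr_const; apply: eq_big => [i|i /negbTE ->]; first by rewrite inE.
  by rewrite sumr_const.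
rewrite ler_wpM2r ?exprn_ge0// lerXn2r ?nnegrE// ler_nat.
by apply: (leq_trans (card_size _)); rewrite size_codom card_ord.
Qed.

End pattern_sums.

Definition pattern_count (R : realType) (K : finType) n
  (F : {ffun 'I_n -> K} -> R) (c : K -> nat) : R := \sum_k F k * \prod_i (c (k i))%:R.

Definition total_count (R : realType) (K : finType) (c : K -> nat) : R :=
  \sum_x (c x)%:R.

(** Contribution to the second moment of the pairs of patterns with at least two prescribed shared
    cells. Every exponent of [mu] is at most 2n - 2. *)
Definition pattern_error (R : realType) (n : nat) (mu : R) : R :=
  \sum_(A : {set 'I_n} | (1 < #|A|)%N) n%:R ^+ #|A| * mu ^+ (n + (n - #|A|)).

Section poisson_count.
Context d (T : measurableType d) (R : realType) (P : probability T R).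
Context (K : finType) (X : K -> T -> nat) (dl : R).
Hypothesis dl0 : 0 < dl.
Hypothesis pX : forall x, poisson_rv P dl (X x).
Hypothesis indepX : forall (h : K -> nat -> R) (e : K -> R),
  (forall x k, 0 <= h x k) ->
  (forall x, \int[P]_t (h x (X x t))%:E = (e x)%:E)%E ->
  (\int[P]_t (\prod_x h x (X x t))%:E = (\prod_x e x)%:E)%E.

Let measurable_comp (h : nat -> R) x : measurable_fun setT (fun t => h (X x t)).
Proof. exact: measurableT_comp (pX x).1. Qed.

Lemma poisson_rv_mean N : poisson_rv P dl N -> (\int[P]_t (N t)%:R%:E = dl%:E)%E.
Proof.
move=> pN; have := poisson_rv_chen (h := fun=> 1) dl0 pN (fun=> ler01).
under eq_integral do rewrite mulr1.
by move=> ->; rewrite integral_prob_cst mule1.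
Qed.

Lemma poisson_rv_mean_sqr N : poisson_rv P dl N ->
  (\int[P]_t ((N t)%:R ^+ 2)%:E = (dl + dl ^+ 2)%:E)%E.
Proof.
move=> pN.
have := poisson_rv_chen (h := fun k => k%:R) dl0 pN (fun=> ler0n _ _).
under eq_integral do rewrite -expr2.
move=> ->; under eq_integral do rewrite -natr1 EFinD.
rewrite ge0_integralD//; last first.
  by apply/measurable_EFinP; exact: measurableT_comp pN.1.
rewrite poisson_rv_mean// integral_prob_cst.
by rewrite -EFinD -EFinM mulrDr mulr1 expr2 addrC.
Qed.

(** A cell met by both patterns contributes [dl ^+ 2 + dl = dl ^+ 2 * (1 + dl^-1)], a cell met by
    one of them [dl], any other cell 1. *)
Lemma poisson_count_moment n p (k : 'I_n -> K) (l : 'I_p -> K) :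
  injective k -> injective l ->
  (\int[P]_t ((\prod_i (X (k i) t)%:R) * (\prod_j (X (l j) t)%:R))%:E =
   (dl ^+ (n + p) * \prod_i (1 + dl^-1 * (k i \in codom l)%:R))%:E)%E.
Proof.
move=> kinj linj.
pose h x (j : nat) : R := (if x \in codom k then j%:R else 1) *
  (if x \in codom l then j%:R else 1).
pose e x : R := (if x \in codom k then dl else 1) * (if x \in codom l then dl else 1)
  * (if x \in codom k then 1 + dl^-1 * (x \in codom l)%:R else 1).
transitivity (\int[P]_t (\prod_x h x (X x t))%:E)%E.
  apply: eq_integral => t _; congr EFin.
  rewrite big_split/= -!big_mkcond/=.
  by rewrite (prod_codom (fun x => (X x t)%:R) kinj) (prod_codom (fun x => (X x t)%:R) linj).
rewrite (indepX (e := e)).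
- congr EFin; rewrite !big_split/= -!big_mkcond/= !prodr_const.
  rewrite (prod_codom (fun x => 1 + dl^-1 * (x \in codom l)%:R) kinj).
  by rewrite !card_codom// !card_ord exprD.
- by move=> x j; rewrite /h; do 2 case: ifP => _; rewrite ?mulr1 ?mul1r// mulr_ge0.
- move=> x; rewrite /h /e; case: ifPn => _; case: ifPn => _.
  + under eq_integral do rewrite -expr2.
    rewrite (poisson_rv_mean_sqr (pX x)); congr EFin.
    by rewrite /= mulr1; field; rewrite gt_eqF.
  + under eq_integral do rewrite mulr1.
    by rewrite (poisson_rv_mean (pX x)) /= mulr0n mulr0 addr0 !mulr1.
  + under eq_integral do rewrite mul1r.
    by rewrite (poisson_rv_mean (pX x)) mul1r mulr1.
  + under eq_integral do rewrite mulr1.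
    by rewrite integral_prob_cst !mulr1.
Qed.

(** The moment of [G i] is required only where its weight is nonzero, since the product formula
    above is for injective patterns. *)
Lemma integral_sum_fin (I : finType) (a c : I -> R) (G : I -> T -> R) :
  (forall i, 0 <= a i) -> (forall i t, 0 <= G i t) ->
  (forall i, measurable_fun setT (G i)) ->
  (forall i, a i != 0 -> (\int[P]_t (G i t)%:E = (c i)%:E)%E) ->
  (\int[P]_t (\sum_i a i * G i t)%:E = (\sum_i a i * c i)%:E)%E.
Proof.
move=> a0 G0 mG Gc.
under eq_integral do rewrite -sumEFin.
have maG i : measurable_fun setT (fun t => (a i * G i t)%:E).
  by apply/measurable_EFinP; apply: measurable_funM.
rewrite ge0_integral_sum//; last by move=> i t _; rewrite lee_fin mulr_ge0.
rewrite -sumEFin; apply: eq_bigr => i _.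
under eq_integral do rewrite EFinM.
rewrite ge0_integralZl//; last 3 first.
- exact/measurable_EFinP.
- by move=> t _; rewrite lee_fin.
- by rewrite lee_fin.
have [->|ai] := eqVneq (a i) 0; first by rewrite mul0e mul0r.
by rewrite Gc// EFinM.
Qed.

Context (n : nat) (F : {ffun 'I_n -> K} -> R).
Hypothesis F0 : forall k, 0 <= F k.
Hypothesis F1 : forall k, F k <= 1.
Hypothesis F_inj : forall k, F k != 0 -> injective k.
Hypothesis F_hom : forall i x y,
  \sum_(k : {ffun 'I_n -> K} | k i == x) F k = \sum_(k : {ffun 'I_n -> K} | k i == y) F k.

Let S := \sum_k F k.
Let mu := dl * #|K|%:R.

Let measurable_prod_count p (l : 'I_p -> K) :
  measurable_fun setT (fun t => \prod_i (X (l i) t)%:R : R).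
Proof.
by apply: measurable_prod => i _; exact: (measurable_comp (fun k => k%:R)).
Qed.

Lemma pattern_count_mean : (\int[P]_t (pattern_count F (X ^~ t))%:E = (dl ^+ n * S)%:E)%E.
Proof.
rewrite (@integral_sum_fin _ _ (fun=> dl ^+ n))//.
- by rewrite /S mulr_sumr; congr EFin; apply: eq_bigr => k _; rewrite mulrC.
- by move=> k t; exact: prodr_ge0.
- move=> k Fk.
  have l : 'I_0 -> K by case.
  have linj : injective l by case.
  have := poisson_count_moment (F_inj Fk) linj.
  under eq_integral do rewrite big_ord0 mulr1.
  move=> ->; congr EFin; rewrite addn0 big1 ?mulr1// => i _.
  rewrite [_ \in _](_ : _ = false) ?mulr0 ?addr0//.
  by apply/negbTE/negP => /codomP[[]].
Qed.

(** The total count is a sum of patterns with a single cell. For injective [k], summing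
    [1 + dl^-1 * (x \in codom k)%:R] over all cells [x] gives [#|K| + n / dl], and a factor [dl]
    turns this into [mu + n]. *)
Lemma pattern_count_total_mean :
  (\int[P]_t (pattern_count F (X ^~ t) * total_count R (X ^~ t))%:E = (dl ^+ n * S * (mu + n%:R))%:E)%E.
Proof.
pose a (p : {ffun 'I_n -> K} * K) := F p.1.
pose G (p : {ffun 'I_n -> K} * K) t : R :=
  (\prod_(i < 1) (X p.2 t)%:R) * \prod_i (X (p.1 i) t)%:R.
transitivity (\int[P]_t (\sum_p a p * G p t)%:E)%E.
  apply: eq_integral => t _; congr EFin.
  rewrite /pattern_count /total_count mulr_suml.
  under eq_bigr do rewrite mulr_sumr.
  rewrite pair_big/=; apply: eq_bigr => p _.
  by rewrite /a /G big_ord1; ring.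
pose c (p : {ffun 'I_n -> K} * K) : R :=
  dl ^+ n.+1 * (1 + dl^-1 * (p.2 \in codom p.1)%:R).
rewrite (@integral_sum_fin _ _ c)//.
- congr EFin; rewrite -(pair_big xpredT xpredT (fun k x => F k * (dl ^+ n.+1 *
    (1 + dl^-1 * (x \in codom k)%:R))))/=.
  rewrite /S mulr_sumr mulr_suml; apply: eq_bigr => k _.
  have [->|Fk] := eqVneq (F k) 0.
    by rewrite mulr0 mul0r big1// => x _; rewrite mul0r.
  rewrite -mulr_sumr -mulr_sumr big_split/= sumr_const -mulr_sumr.
  have -> : \sum_x (x \in codom k)%:R = n%:R :> R.
    rewrite -natr_sum; congr _%:R.
    transitivity #|codom k|; last by rewrite (card_codom (F_inj Fk)) card_ord.
    by rewrite -sum1_card [in RHS]big_mkcond.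
  by rewrite /mu exprS -mulr_natl; field; rewrite gt_eqF.
- by move=> p; exact: F0.
- by move=> p t; rewrite /G mulr_ge0// prodr_ge0.
- by move=> p; apply: measurable_funM => //; exact: (measurable_prod_count (fun=> p.2)).
- move=> p ap.
  have kinj : injective (fun i : 'I_1 => p.2) by move=> i j _; rewrite !ord1.
  by have := poisson_count_moment kinj (F_inj ap); rewrite big_ord1.
Qed.

Lemma pattern_count_sqr_mean : (0 < #|K|)%N ->
  (\int[P]_t ((pattern_count F (X ^~ t)) ^+ 2)%:E <=
   ((dl ^+ n * S) ^+ 2 + (n%:R * (dl ^+ n * S)) ^+ 2 / mu + pattern_error n mu)%:E)%E.
Proof.
move=> K0; have K0' : (0 : R) < #|K|%:R by rewrite ltr0n.
pose a (p : {ffun 'I_n -> K} * {ffun 'I_n -> K}) := F p.1 * F p.2.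
pose G (p : {ffun 'I_n -> K} * {ffun 'I_n -> K}) t : R :=
  (\prod_i (X (p.1 i) t)%:R) * \prod_i (X (p.2 i) t)%:R.
have -> : (\int[P]_t ((pattern_count F (X ^~ t)) ^+ 2)%:E = \int[P]_t (\sum_p a p * G p t)%:E)%E.
  apply: eq_integral => t _; congr EFin.
  rewrite expr2 /pattern_count mulr_suml.
  under eq_bigr do rewrite mulr_sumr.
  rewrite pair_big/=; apply: eq_bigr => p _.
  by rewrite /a /G; ring.
pose c (p : {ffun 'I_n -> K} * {ffun 'I_n -> K}) : R := dl ^+ (n + n) *
    \prod_i (1 + dl^-1 * (p.1 i \in codom p.2)%:R).
rewrite (@integral_sum_fin _ _ c); first last.
- move=> p; rewrite mulf_eq0 negb_or => /andP[p1 p2].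
  exact: (poisson_count_moment (F_inj p1) (F_inj p2)).
- by move=> p; apply: measurable_funM => //; exact: measurable_prod_count.
- by move=> p t; rewrite /G mulr_ge0// prodr_ge0.
- by move=> p; rewrite /a mulr_ge0.
rewrite lee_fin.
have -> : \sum_p a p * c p =
    \sum_(A : {set 'I_n}) dl ^+ (n + n) * dl^-1 ^+ #|A| * overlap F A.
  rewrite -(pair_big xpredT xpredT (fun k l => F k * F l * (dl ^+ (n + n) *
     \prod_i (1 + dl^-1 * (k i \in codom (l : {ffun 'I_n -> K}))%:R))))/=.
  under eq_bigr do under eq_bigr do rewrite prod1D_sum mulr_sumr mulr_sumr.
  under [RHS]eq_bigr do rewrite /overlap mulr_sumr.
  rewrite [RHS]exchange_big/=; apply: eq_bigr => k _.
  under [RHS]eq_bigr do rewrite mulr_sumr.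
  rewrite [RHS]exchange_big/=; apply: eq_bigr => l _.
  by apply: eq_bigr => A _; ring.
(* Each [A] is charged to one of three pieces, according as it has no element, one or more. The
   indicators allow a comparison term by term, after which the sums separate. *)
apply: (@le_trans _ _ (\sum_(A : {set 'I_n}) ((A == finset.set0)%:R * (dl ^+ n * S) ^+ 2 +
   \sum_i (A == [set i]%SET)%:R * (n%:R * (dl ^+ n * S) ^+ 2 / mu) +
   (if (1 < #|A|)%N then n%:R ^+ #|A| * mu ^+ (n + (n - #|A|)) else 0)))).
  apply: ler_sum => A _.
  have mu0 : 0 < mu by rewrite mulr_gt0.
  have t0 : 0 <= (A == finset.set0)%:R * (dl ^+ n * S) ^+ 2 by rewrite mulr_ge0// sqr_ge0.
  have t1 i : 0 <= (A == [set i]%SET)%:R * (n%:R * (dl ^+ n * S) ^+ 2 / mu).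
    by rewrite mulr_ge0// divr_ge0 ?(ltW mu0)// mulr_ge0// sqr_ge0.
  have [A1|A1|A1] := ltngtP #|A| 1.
  - have A0 : A = finset.set0 by apply: cards0_eq; case: #|A| A1.
    have -> : dl ^+ (n + n) * dl^-1 ^+ #|A| * overlap F A = (dl ^+ n * S) ^+ 2.
      by rewrite A0 cards0 expr0 mulr1 overlap0 -/S exprMn -exprM muln2 addnn.
    have s0 : 0 <= \sum_i (A == [set i]%SET)%:R * (n%:R * (dl ^+ n * S) ^+ 2 / mu).
      by apply: sumr_ge0 => i _.
    by move: s0; rewrite A0 eqxx mul1r addr0 lerDl.
  - have An : (#|A| <= n)%N by rewrite -[leqRHS]card_ord max_card.
    apply: (@le_trans _ _ (n%:R ^+ #|A| * mu ^+ (n + (n - #|A|)))); last first.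
      by rewrite lerDr addr_ge0// sumr_ge0.
    have := overlap_le F0 F1 A.
    have c0 : 0 <= dl ^+ (n + n) * dl^-1 ^+ #|A|.
      by rewrite mulr_ge0// exprn_ge0// ?invr_ge0 ltW.
    move=> /(ler_wpM2l c0) /le_trans; apply; rewrite le_eqVlt; apply/orP; left; apply/eqP.
    by apply: expr_excess => //; rewrite gt_eqF.
  - have /cards1P[i Ai] : #|A| == 1%N by rewrite A1.
    rewrite Ai cards1 expr1 addr0 (bigD1 i)//= eqxx mul1r.
    apply: (@le_trans _ _ (n%:R * (dl ^+ n * S) ^+ 2 / mu)); last first.
      rewrite -Ai addrCA lerDl addr_ge0// sumr_ge0//.
    have c0 : 0 <= dl ^+ (n + n) / mu.
      by rewrite divr_ge0 ?(ltW mu0)// exprn_ge0// ltW.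
    have := ler_wpM2l c0 (overlap1 F0 F_hom i); rewrite -/S.
    have -> : dl ^+ (n + n) / mu * (#|K|%:R * overlap F [set i]%SET) =
       dl ^+ (n + n) / dl * overlap F [set i]%SET.
      by rewrite /mu; field; rewrite !gt_eqF.
    move=> /le_trans; apply; rewrite exprD le_eqVlt; apply/orP; left; apply/eqP.
    by ring.
rewrite !big_split/= -big_mkcond/= lerD2r lerD//.
  by rewrite -mulr_suml (bigD1 finset.set0)//= eqxx big1 ?addr0 ?mul1r// => A /negbTE ->.
rewrite exchange_big/= (eq_bigr (fun=> n%:R * (dl ^+ n * S) ^+ 2 / mu)); last first.
  move=> i _; rewrite -mulr_suml (bigD1 [set i]%SET)//= eqxx.
  by rewrite big1 ?addr0 ?mul1r// => A /negbTE ->.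
by rewrite sumr_const card_ord -mulr_natl exprMn; lra.
Qed.

End poisson_count.

(** * Discretization of the torus *)

Section torus_grid.
Context {R : realType}.
Variables (d : nat) (a : R).
Hypothesis a0 : 0 < a.
Local Notation borelR := (measurableTypeR R).
Local Notation point := (d.-tuple borelR).
Implicit Types x y : point.

(** The distance depends only on [x - y] modulo the lattice; [z] records the wrap-around. It serves
    with [e = 0] for translations and with [z = 0] for rounding to corners. *)
Lemma torus_dist_le x y x' y' (e : R) (z : 'I_d -> int) : 0 <= e ->
  (forall i, `|((tnth x i : R) - tnth y i) - ((tnth x' i : R) - tnth y' i) -
     (z i)%:~R * a| <= e) ->
  torus_dist a x' y' <= torus_dist a x y + e.
Proof.
move=> e0 xy; rewrite -lerBlDr; apply: lb_le_inf.
  by exists `|\row_(i < d) ((tnth x i : R) - tnth y i + ((fun=> 0) i)%:~R * a)|, (fun=> 0).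
move=> _ [m _ <-]; rewrite lerBlDr.
pose m' i := m i + z i.
apply: (@le_trans _ _ `|\row_(i < d) ((tnth x' i : R) - tnth y' i + (m' i)%:~R * a)|).
  apply: ge_inf; last by exists m'.
  by exists 0 => _ [? _ <-].
have -> : \row_(i < d) ((tnth x' i : R) - tnth y' i + (m' i)%:~R * a) =
   \row_(i < d) ((tnth x i : R) - tnth y i + (m i)%:~R * a) -
   \row_(i < d) (((tnth x i : R) - tnth y i) - ((tnth x' i : R) - tnth y' i) -
     (z i)%:~R * a).
  by apply/rowP => i; rewrite !mxE /m' intrD; ring.
apply: (le_trans (ler_normB _ _)); rewrite lerD2l.
rewrite [leLHS]mx_normrE; apply/bigmax_leP; split => // -[i j] _ /=.
by rewrite mxE.
Qed.

Section grid.
Variable m : nat.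
Let K := {ffun 'I_d -> 'I_m.+1}.
Let eta : R := a / m.+1%:R.

Let eta0 : 0 < eta. Proof. by rewrite divr_gt0. Qed.

Definition cell (k : K) : set point :=
  [set x | forall i, eta * (k i)%:R <= (tnth x i : R) < eta * (k i).+1%:R].

Definition corner (k : K) : point := [tuple eta * (k i)%:R : borelR | i < d].

(** Meaningful on the torus only: there the truncation is below [m.+1], so [inord] does not fall
    back on its default value. *)
Definition cell_of (x : point) : K :=
  [ffun i => inord (Num.truncn ((tnth x i : R) / eta))].

Lemma measurable_box (A : 'I_d -> set borelR) : (forall i, measurable (A i)) ->
  measurable [set x : point | forall i, A i (tnth x i)].
Proof.
move=> mA; rewrite (_ : [set _ | _] = \bigcap_(i in [set: 'I_d])
    ((@tnth d borelR)^~ i @^-1` A i)).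
  apply: fin_bigcap_measurable => // i _.
  by rewrite -[X in measurable X]setTI; exact: measurable_tnth.
by apply/seteqP; split => x /= Bx i; [move=> _|]; exact: Bx.
Qed.

Let cell_box k : cell k = [set x | forall i,
  `[eta * (k i)%:R, eta * (k i).+1%:R[%classic (tnth x i : R)].
Proof. by apply/seteqP; split => x /= H i; have := H i; rewrite in_itv. Qed.

Let torus_box : @torus R d a = [set x | forall i, `[0, a[%classic (tnth x i : R)].
Proof. by apply/seteqP; split => x /= H i; have := H i; rewrite in_itv. Qed.

Lemma measurable_torus : measurable (@torus R d a).
Proof.
rewrite torus_box; apply: (measurable_box (A := fun=> `[0, a[%classic)) => i.
exact: measurable_itv.
Qed.

Lemma measurable_cell k : measurable (cell k).
Proof.
rewrite cell_box; apply: (measurable_box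
  (A := fun i => `[eta * (k i)%:R, eta * (k i).+1%:R[%classic)) => i.
exact: measurable_itv.
Qed.

Lemma lebesgue_torus : lebesgue_tuple d (@torus R d a) = (a ^+ d)%:E.
Proof.
rewrite torus_box (lebesgue_tuple_box (A := fun=> `[0, a[%classic)); last first.
  by move=> i; exact: measurable_itv.
under eq_bigr do rewrite lebesgue_measure_itv /= lte_fin a0 sube0.
by rewrite prodEFin prodr_const card_ord.
Qed.

Lemma lebesgue_cell k : lebesgue_tuple d (cell k) = (eta ^+ d)%:E.
Proof.
rewrite cell_box (lebesgue_tuple_box
  (A := fun i => `[eta * (k i)%:R, eta * (k i).+1%:R[%classic)); last first.
  by move=> i; exact: measurable_itv.
transitivity (\prod_(i < d) eta%:E)%E; last by rewrite prodEFin prodr_const card_ord.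
apply: eq_bigr => i _.
rewrite lebesgue_measure_itv /= lte_fin ltr_pM2l// ltr_nat leqnn.
by rewrite -EFinB -mulrBr -natr1 addrAC subrr add0r mulr1.
Qed.

Lemma eta_card : eta ^+ d * #|K|%:R = a ^+ d.
Proof.
rewrite card_ffun !card_ord natrX -exprMn /eta mulfVK//.
Qed.

Lemma cell_torus k : cell k `<=` @torus R d a.
Proof.
move=> x kx i; have /andP[h1 h2] := kx i; apply/andP; split.
  by apply: le_trans h1; rewrite mulr_ge0// ltW.
apply: (lt_le_trans h2); rewrite -[leRHS](@divfK _ m.+1%:R)// ler_pM2l//.
by rewrite ler_nat ltn_ord.
Qed.

Lemma cell_ofP x k : torus a x -> cell k x <-> cell_of x = k.
Proof.
move=> tx; have tr i : (Num.truncn ((tnth x i : R) / eta) < m.+1)%N.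
  have /andP[h1 h2] := tx i.
  rewrite truncn_lt_nat; last by rewrite divr_ge0// ltW.
  by rewrite ltr_pdivrMr// /eta mulrCA divff// mulr1.
split.
  move=> kx; apply/ffunP => i; rewrite ffunE; apply: val_inj.
  rewrite /= inordK//.
  have /andP[h1 h2] := kx i; apply/eqP; rewrite truncn_eq.
    by rewrite ler_pdivlMr// ltr_pdivrMr// ![_ * eta]mulrC h1 h2.
  by rewrite divr_ge0 ?(ltW eta0)//; have /andP[] := tx i.
move=> <- i; rewrite ffunE inordK// mulrC -ler_pdivlMr//.
have x0 : 0 <= (tnth x i : R) / eta by rewrite divr_ge0 ?(ltW eta0)//; have /andP[] := tx i.
rewrite [eta * _]mulrC -ltr_pdivrMr//.
exact: truncn_itv.
Qed.

Lemma trivIset_cell (A : set K) : trivIset A cell.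
Proof.
apply/trivIsetP => k l _ _ kl; apply/seteqP; split => // x [kx lx].
have tx := cell_torus kx.
by move: kl; rewrite -((cell_ofP k tx).1 kx) -((cell_ofP l tx).1 lx) eqxx.
Qed.

(* Cells are indexed by a power of the cyclic group 'I_m.+1, whose addition
   translates the torus. *)
Lemma corner_addE (k z : K) i :
  tnth (corner (k + z)) i = (tnth (corner k) i : R) + tnth (corner z) i -
    ((k i + z i) %/ m.+1)%:R * a.
Proof.
rewrite !tnth_mktuple ffunE.
have -> : (k i + z i)%R = ((k i + z i) %% m.+1)%N :> nat by [].
have := divn_eq (k i + z i) m.+1; set q := (_ %/ _)%N; set r := (_ %% _)%N => E.
have /(congr1 (fun j : nat => j%:R : R)) := E.
rewrite !natrD natrM => E'.
have -> : a = eta * m.+1%:R by rewrite /eta divfK.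
rewrite mulrCA -mulrDr -mulrBr; congr (_ * _).
by rewrite E' addrC addKr.
Qed.

(** Adding [z] shifts both corners equally up to carries, which are multiples of [a]; their
    difference [q] is absorbed by the lattice. *)
Lemma corner_dist_translate (k l z : K) :
  torus_dist a (corner (k + z)) (corner (l + z)) = torus_dist a (corner k) (corner l).
Proof.
apply/eqP; rewrite eq_le -[in leRHS](addr0 (torus_dist _ (corner k) _)).
rewrite -[X in _ && (_ <= X)](addr0 (torus_dist _ (corner (k + z)) _)).
pose q i : int := ((k i + z i) %/ m.+1)%:Z - ((l i + z i) %/ m.+1)%:Z.
apply/andP; split.
  apply: (torus_dist_le (z := q)) => // i; rewrite !corner_addE /q intrB.
  by rewrite le_eqVlt normr_eq0; apply/orP; left; apply/eqP; rewrite -!pmulrn; ring.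
apply: (torus_dist_le (z := fun i => - q i)) => // i; rewrite !corner_addE /q intrN intrB.
by rewrite le_eqVlt normr_eq0; apply/orP; left; apply/eqP; rewrite -!pmulrn; ring.
Qed.

Lemma corner_cell_of x i : torus a x ->
  0 <= (tnth x i : R) - tnth (corner (cell_of x)) i <= eta.
Proof.
move=> tx; have /(_ i)/andP[h1 h2] := (cell_ofP (cell_of x) tx).2 erefl.
rewrite tnth_mktuple subr_ge0 h1 lerBlDr addrC -[X in _ + X]mulr1 -mulrDr natr1.
exact: ltW.
Qed.

(** The offsets of [x] and [y] from their corners both lie in [[0, eta]], so they differ by at most
    [eta] rather than [2 * eta]. *)
Lemma corner_dist_le x y : torus a x -> torus a y ->
  `|torus_dist a (corner (cell_of x)) (corner (cell_of y)) - torus_dist a x y| <= eta.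
Proof.
move=> tx ty; rewrite ler_distl lerBlDr.
have H i : `|((tnth x i : R) - tnth (corner (cell_of x)) i) -
             ((tnth y i : R) - tnth (corner (cell_of y)) i)| <= eta.
  have := corner_cell_of i tx; have := corner_cell_of i ty.
  by rewrite ler_norml => /andP[? ?] /andP[? ?]; apply/andP; split; lra.
apply/andP; split; apply: (torus_dist_le (z := fun=> 0)); rewrite ?(ltW eta0)// => i;
  apply: le_trans (H i); rewrite mul0r subr0.
  by rewrite -normrN le_eqVlt; apply/orP; left; apply/eqP; congr `|_|; ring.
by rewrite le_eqVlt; apply/orP; left; apply/eqP; congr `|_|; ring.
Qed.

Lemma corner_dist_lt x y r : torus a x -> torus a y ->
  torus_dist a (corner (cell_of x)) (corner (cell_of y)) + eta < r ->
  torus_dist a x y < r.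
Proof.
move=> tx ty; apply: le_lt_trans.
by have := corner_dist_le tx ty; rewrite ler_distl => /andP[h1 h2]; lra.
Qed.

Lemma lt_corner_dist x y r : torus a x -> torus a y ->
  eta < (r - torus_dist a x y) / 2 ->
  torus_dist a (corner (cell_of x)) (corner (cell_of y)) + eta < r.
Proof.
move=> tx ty.
by have := corner_dist_le tx ty; rewrite ler_distl => /andP[h1 h2]; lra.
Qed.

Lemma same_cell_le x y i : torus a x -> torus a y -> cell_of x = cell_of y ->
  `|(tnth x i : R) - tnth y i| <= eta.
Proof.
move=> tx ty E; have := corner_cell_of i tx; have := corner_cell_of i ty; rewrite E.
generalize (tnth (corner (cell_of y)) i : R) (tnth x i : R) (tnth y i : R) => u v w.
by move=> /andP[h1 h2] /andP[h3 h4]; rewrite ler_norml; apply/andP; split; lra.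
Qed.

End grid.
End torus_grid.

Lemma near_forall_fin (I : finType) (Q : I -> nat -> Prop) :
  (forall i, \forall m \near \oo, Q i m) -> \forall m \near \oo, forall i, Q i m.
Proof.
move=> QN; have /choice[N HN] : forall i, exists N, forall m, (N <= m)%N -> Q i m.
  by move=> i; have [N _ HN] := QN i; exists N.
exists (\max_i N i)%N => // m /= Nm i; apply: HN.
exact: leq_trans (leq_bigmax i) Nm.
Qed.

(** * Counts of the complex on the grid *)

Section discretization.
Context {R : realType}.
Variables (d : nat) (a : R).
Hypothesis a0 : 0 < a.
Local Notation borelR := (measurableTypeR R).
Local Notation point := (d.-tuple borelR).
Variables (eps : R) (n : nat) (Gamma : simplicial_complex 'I_n).
Let sym : R := (@nb_symmetries R d a eps n Gamma)%:R.

Lemma nb_symmetries_gt0 : (0 < @nb_symmetries R d a eps n Gamma)%N.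
Proof.
apply/card_gt0P; exists 1%g; rewrite inE; apply/asboolP => v _.
by congr edges_appear; apply/funext => i /=; rewrite perm1.
Qed.

Let sym_ge1 : 1 <= sym. Proof. by rewrite ler1n nb_symmetries_gt0. Qed.

Let sym_gt0 : 0 < sym. Proof. exact: lt_le_trans ltr01 sym_ge1. Qed.

(** Composing with a permutation permutes the injective tuples, so every term of the symmetrization
    has the same sum. *)
Lemma nb_occurrencesE (omega : {fset point}) :
  nb_occurrences a eps Gamma omega =
  \sum_(v : {ffun 'I_n -> omega} | injectiveb v)
     edges_appear a eps Gamma (fun i => val (v i)) / sym.
Proof.
rewrite /nb_occurrences /kernel_sym -mulr_sumr exchange_big/=.
have E (s : 'S_n) : \sum_(v : {ffun 'I_n -> omega} | injectiveb v)
    kernel_raw a eps Gamma ((fun i => val (v i)) \o s) =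
  \sum_(v : {ffun 'I_n -> omega} | injectiveb v)
     edges_appear a eps Gamma (fun i => val (v i)) / sym.
  pose h (v : {ffun 'I_n -> omega}) : {ffun 'I_n -> omega} := [ffun i => v (s^-1%g i)].
  have hinj : injective h.
    move=> u v /ffunP uv; apply/ffunP => i.
    by have := uv (s i); rewrite !ffunE permK.
  rewrite (reindex_inj hinj)/=; apply: eq_big => [v|v _].
    apply/injectiveP/injectiveP => vi i j.
      by move=> vij; apply: (@perm_inj _ s); apply: vi; rewrite !ffunE !permK.
    by rewrite !ffunE => /vi/perm_inj.
  rewrite /kernel_raw; congr (edges_appear _ _ _ _ / _).
  by apply/funext => i /=; rewrite ffunE permK.
rewrite (eq_bigr _ (fun s _ => E s)) sumr_const card_Sn -[X in _ * X]mulr_natl.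
by rewrite mulKf// pnatr_eq0 -lt0n fact_gt0.
Qed.

(* The extra side length a / m.+1 makes the count on the grid a lower bound of
   the number of occurrences, with equality on fine grids. *)
Definition grid_kernel m (k : {ffun 'I_n -> {ffun 'I_d -> 'I_m.+1}}) : R :=
  if injectiveb k then
    (\prod_(ij : 'I_n * 'I_n | edge Gamma ij.1 ij.2)
      (torus_dist a (corner a (k ij.1)) (corner a (k ij.2)) + a / m.+1%:R < 2 * eps)%R%:R)
    / sym
  else 0.

Let prod_bool01 (I : finType) (Q : pred I) (b : I -> bool) :
  0 <= (\prod_(i | Q i) (b i)%:R : R) <= 1.
Proof.
apply/andP; split; first exact: prodr_ge0.
by apply: prodr_ile1 => i _; rewrite ler0n/=; case: (b i).
Qed.

Lemma grid_kernel_ge0 m k : 0 <= @grid_kernel m k.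
Proof.
rewrite /grid_kernel; case: ifP => // _; rewrite divr_ge0 ?(ltW sym_gt0)//.
by have /andP[] := prod_bool01 (fun ij => edge Gamma ij.1 ij.2)
  (fun ij => torus_dist a (corner a (k ij.1)) (corner a (k ij.2)) + a / m.+1%:R < 2 * eps).
Qed.

Lemma grid_kernel_le1 m k : @grid_kernel m k <= 1.
Proof.
rewrite /grid_kernel; case: ifP => // _; rewrite ler_pdivrMr// mul1r.
apply: le_trans sym_ge1.
by have /andP[] := prod_bool01 (fun ij => edge Gamma ij.1 ij.2)
  (fun ij => torus_dist a (corner a (k ij.1)) (corner a (k ij.2)) + a / m.+1%:R < 2 * eps).
Qed.

Lemma grid_kernel_inj m k : @grid_kernel m k != 0 -> injective k.
Proof. by rewrite /grid_kernel; case: ifP => [/injectiveP//|]; rewrite eqxx. Qed.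

(** Discrete translation invariance, the homogeneity required by the moment bounds: the whole
    pattern is moved by [x - y]. *)
Lemma grid_kernel_translate m i x y :
  \sum_(k : {ffun 'I_n -> {ffun 'I_d -> 'I_m.+1}} | k i == x) grid_kernel k =
  \sum_(k : {ffun 'I_n -> {ffun 'I_d -> 'I_m.+1}} | k i == y) grid_kernel k.
Proof.
pose h (k : {ffun 'I_n -> {ffun 'I_d -> 'I_m.+1}}) :
  {ffun 'I_n -> {ffun 'I_d -> 'I_m.+1}} := [ffun j => k j + (x - y)].
have hinj : injective h.
  move=> u v /ffunP uv; apply/ffunP => j.
  by have := uv j; rewrite !ffunE => /addIr.
rewrite (reindex_inj hinj)/=; apply: eq_big => [k|k _].
  rewrite /h ffunE; apply/eqP/eqP => [E|->]; last by rewrite addrC subrK.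
  by apply: (addIr (x - y)); rewrite E addrC subrK.
rewrite /grid_kernel.
have -> : injectiveb (h k) = injectiveb k.
  apply/injectiveP/injectiveP => kinj u v; last by rewrite !ffunE => /addIr/kinj.
  by move=> kuv; apply: kinj; rewrite !ffunE kuv.
case: ifP => // _; congr (_ / _); apply: eq_bigr => ij _.
by rewrite !ffunE corner_dist_translate.
Qed.

Lemma nb_pointsE (A : set point) (omega : {fset point}) :
  nb_points A omega = (\sum_(x : omega) (val x \in A))%N.
Proof.
rewrite /nb_points card_fset_sum1 big_fset/= big_mkcond/= big_seq_fsetE/=.
by apply: eq_bigr => x _; case: (_ \in A).
Qed.

(** A product of cell counts enumerates the choices of one point per cell, and each tuple of points
    follows exactly one pattern, that of its own cells. *)
Lemma grid_countE m (omega : {fset point}) :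
  (forall x, x \in omega -> torus a x) ->
  pattern_count (@grid_kernel m) (fun k => nb_points (cell a k) omega) =
  \sum_(v : {ffun 'I_n -> omega}) grid_kernel [ffun i => cell_of a m (val (v i))].
Proof.
move=> omT; rewrite /pattern_count.
transitivity (\sum_(k : {ffun 'I_n -> {ffun 'I_d -> 'I_m.+1}})
   \sum_(v : {ffun 'I_n -> omega})
     (if k == [ffun i => cell_of a m (val (v i))] then grid_kernel k else 0)).
  apply: eq_bigr => k _.
  under eq_bigr do rewrite nb_pointsE natr_sum.
  rewrite bigA_distr_bigA mulr_sumr; apply: eq_bigr => v _.
  have cE i : (val (v i) \in cell a (k i)) = (cell_of a m (val (v i)) == k i).
    have tv := omT _ (valP (v i)).
    by apply/idP/eqP => [/set_mem|/(cell_ofP a0 _ tv).2 /mem_set//];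
      move/(cell_ofP a0 _ tv).1.
  case: eqP => [kE|kv].
    rewrite big1 ?mulr1// => i _; rewrite cE kE ffunE eqxx//.
  suff [i ki] : exists i, cell_of a m (val (v i)) != k i.
    by rewrite (bigD1 i)//= cE (negbTE ki) mul0r mulr0.
  apply/existsP; apply: contra_notT kv => /existsPn kv.
  by apply/ffunP => i; rewrite ffunE; apply/esym/eqP; have := kv i; rewrite negbK.
rewrite exchange_big/=; apply: eq_bigr => v _.
by rewrite -big_mkcond big_pred1_eq.
Qed.

Lemma grid_term_le m (omega : {fset point}) (v : {ffun 'I_n -> omega}) :
  (forall x, x \in omega -> torus a x) ->
  grid_kernel [ffun i => cell_of a m (val (v i))] <=
  if injectiveb v then edges_appear a eps Gamma (fun i => val (v i)) / sym else 0.
Proof.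
move=> omT; rewrite /grid_kernel; case: ifPn => [/injectiveP kinj|_]; last first.
  by case: ifP => // _; rewrite divr_ge0 ?(ltW sym_gt0)// prodr_ge0.
have -> : injectiveb v.
  by apply/injectiveP => i j vij; apply: kinj; rewrite !ffunE vij.
rewrite ler_pM2r ?invr_gt0//; apply: ler_prod => -[i j] /= _.
rewrite ler0n/= ler_nat !ffunE.
case: ltP => //= h; suff -> : torus_dist a (val (v i)) (val (v j)) < 2 * eps by [].
exact: corner_dist_lt (omT _ (valP (v i))) (omT _ (valP (v j))) h.
Qed.

(** For a fixed finite configuration the mesh is eventually below the separation of distinct points
    and below half of each positive gap to [2 * eps]. A pair at distance at least [2 * eps] is
    rejected on every grid, so the boundary case needs no almost sure argument. *)
Lemma grid_term_cvg (omega : {fset point}) (v : {ffun 'I_n -> omega}) :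
  (forall x, x \in omega -> torus a x) ->
  \forall m \near \oo, grid_kernel [ffun i => cell_of a m (val (v i))] =
  if injectiveb v then edges_appear a eps Gamma (fun i => val (v i)) / sym else 0.
Proof.
move=> omT.
have eta_lt (e : R) : 0 < e -> \forall m \near \oo, a / m.+1%:R < e.
  move=> e0; near=> m; rewrite ltr_pdivrMr// -ltr_pdivrMl// mulrC.
  rewrite -natr1; apply: ltr_wpDr => //.
  by near: m; exact: nbhs_infty_gtr.
have [/injectiveP vinj|vninj] := boolP (injectiveb v); last first.
  near=> m; apply/le_anti; rewrite grid_kernel_ge0 andbT.
  by have := grid_term_le m v omT; rewrite (negbTE vninj).
have sep : \forall m \near \oo, forall ij : 'I_n * 'I_n,
    cell_of a m (val (v ij.1)) = cell_of a m (val (v ij.2)) -> ij.1 = ij.2.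
  apply: near_forall_fin => -[i j] /=.
  have [->|ij] := eqVneq i j; first exact: nearW.
  have [c vc] : exists c, tnth (val (v i)) c != tnth (val (v j)) c.
    apply/existsP; apply: contra_neqT ij => /existsPn vij; apply: vinj; apply: val_inj.
    by apply: eq_from_tnth => c; apply/eqP; have := vij c; rewrite negbK.
  have e0 : 0 < `|(tnth (val (v i)) c : R) - tnth (val (v j)) c|.
    by rewrite normr_gt0 subr_eq0.
  near=> m => E; exfalso.
  have := same_cell_le a0 c (omT _ (valP (v i))) (omT _ (valP (v j))) E.
  by apply/negP; rewrite -ltNge; near: m; exact: eta_lt.
have dist : \forall m \near \oo, forall ij : 'I_n * 'I_n,
    (torus_dist a (corner a (cell_of a m (val (v ij.1))))
      (corner a (cell_of a m (val (v ij.2)))) + a / m.+1%:R < 2 * eps) =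
    (torus_dist a (val (v ij.1)) (val (v ij.2)) < 2 * eps).
  apply: near_forall_fin => -[i j] /=.
  have ti := omT _ (valP (v i)); have tj := omT _ (valP (v j)).
  have [h|h] := ltP (torus_dist a (val (v i)) (val (v j))) (2 * eps); last first.
    near=> m; apply/negbTE/negP => /(corner_dist_lt a0 ti tj).
    by apply/negP; rewrite -leNgt.
  by near=> m; apply: (lt_corner_dist a0 ti tj); near: m; apply: eta_lt;
    rewrite divr_gt0// subr_gt0.
near=> m; rewrite /grid_kernel.
have -> : injectiveb [ffun i => cell_of a m (val (v i))].
  apply/injectiveP => i j; rewrite !ffunE => ij.
  have /(_ (i, j)) : forall ij : 'I_n * 'I_n,
    cell_of a m (val (v ij.1)) = cell_of a m (val (v ij.2)) -> ij.1 = ij.2.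
    by near: m.
  exact.
congr (_ / _); apply: eq_bigr => ij _; rewrite !ffunE; congr _%:R; congr nat_of_bool.
by move: ij; near: m.
Unshelve. all: by end_near. Qed.

Lemma grid_count_le m (omega : {fset point}) :
  (forall x, x \in omega -> torus a x) ->
  pattern_count (@grid_kernel m) (fun k => nb_points (cell a k) omega) <=
  nb_occurrences a eps Gamma omega.
Proof.
move=> omT; rewrite grid_countE// nb_occurrencesE [leRHS]big_mkcond.
by apply: ler_sum => v _; exact: grid_term_le.
Qed.

Lemma grid_count_near (omega : {fset point}) :
  (forall x, x \in omega -> torus a x) ->
  \forall m \near \oo,
    pattern_count (@grid_kernel m) (fun k => nb_points (cell a k) omega) =
    nb_occurrences a eps Gamma omega.
Proof.
move=> omT.
have H : \forall m \near \oo, forall v : {ffun 'I_n -> omega},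
  grid_kernel [ffun i => cell_of a m (val (v i))] =
  if injectiveb v then edges_appear a eps Gamma (fun i => val (v i)) / sym else 0.
  by apply: near_forall_fin => v; exact: grid_term_cvg.
near=> m; rewrite grid_countE// nb_occurrencesE [RHS]big_mkcond.
by apply: eq_bigr => v _; move: v; near: m.
Unshelve. all: by end_near. Qed.

Lemma nb_occurrences_le (omega : {fset point}) :
  0 <= nb_occurrences a eps Gamma omega <= #|` omega|%:R ^+ n.
Proof.
rewrite nb_occurrencesE; apply/andP; split.
  by apply: sumr_ge0 => v _; rewrite divr_ge0 ?(ltW sym_gt0)// prodr_ge0.
rewrite big_mkcond -natrX cardfE -[X in (_ ^ X)%N]card_ord -card_ffun -sum1_card natr_sum.
apply: ler_sum => v _; case: ifP => // _.
rewrite ler_pdivrMr// mul1r; apply: le_trans sym_ge1.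
by have /andP[] := prod_bool01 (fun ij => edge Gamma ij.1 ij.2)
  (fun ij => torus_dist a (val (v ij.1)) (val (v ij.2)) < 2 * eps).
Qed.

Lemma total_countE m (omega : {fset point}) :
  (forall x, x \in omega -> torus a x) ->
  total_count R (fun k : {ffun 'I_d -> 'I_m.+1} => nb_points (cell a k) omega) =
  #|` omega|%:R.
Proof.
move=> omT; rewrite /total_count -natr_sum; congr _%:R.
under eq_bigr do rewrite nb_pointsE.
rewrite exchange_big cardfE -sum1_card; apply: eq_bigr => x _.
have tx := omT _ (valP x).
rewrite (bigD1 (cell_of a m (val x)))//= mem_set; last exact: (cell_ofP a0 _ tx).2.
rewrite big1// => k kx; rewrite memNset// => /(cell_ofP a0 _ tx).1 kE.
by rewrite kE eqxx in kx.
Qed.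

Lemma nb_points_torus (omega : {fset point}) :
  (forall x, x \in omega -> torus a x) -> nb_points (torus a) omega = #|` omega|.
Proof.
move=> omT; rewrite nb_pointsE cardfE -sum1_card; apply: eq_bigr => x _.
by rewrite mem_set//; exact: omT (valP x).
Qed.

End discretization.

(** * Comparison with the number of points *)

Section wasserstein_bound.
Context d (T : measurableType d) (R : realType) (P : probability T R).
Variables (N : T -> nat) (G : T -> R) (mu e err c : R).
Hypothesis mu0 : 0 < mu.
Hypothesis pN : poisson_rv P mu N.
Hypothesis iG : P.-integrable setT (fun t => (G t)%:E).
Hypothesis iGN : P.-integrable setT (fun t => (G t * (N t)%:R)%:E).
Hypothesis iG2 : P.-integrable setT (fun t => (G t ^+ 2)%:E).
Hypothesis eE : \int[P]_t G t = e.
Hypothesis EGN : \int[P]_t (G t * (N t)%:R) = e * (mu + c).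
Hypothesis EG2 : \int[P]_t (G t ^+ 2) <= e ^+ 2 + (c * e) ^+ 2 / mu + err.
Hypothesis ce0 : 0 < c * e.

Let iN : P.-integrable setT (fun t => ((N t)%:R : R)%:E).
Proof.
apply: (@poisson_rv_integrable _ _ _ _ _ _ 1 (fun k => k%:R) 1 mu0 pN) => k.
by rewrite expr1 mul1r normr_nat ler_nat.
Qed.

Let iN2 : P.-integrable setT (fun t => ((N t)%:R ^+ 2 : R)%:E).
Proof.
apply: (@poisson_rv_integrable _ _ _ _ _ _ 2 (fun k => k%:R ^+ 2) 1 mu0 pN) => k.
by rewrite mul1r ger0_norm ?sqr_ge0// lerXn2r ?nnegrE// ler_nat.
Qed.

Let EN : \int[P]_t ((N t)%:R : R) = mu.
Proof. by rewrite /Rintegral (poisson_rv_mean mu0 pN). Qed.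

Let EN2 : \int[P]_t ((N t)%:R ^+ 2 : R) = mu + mu ^+ 2.
Proof. by rewrite /Rintegral (poisson_rv_mean_sqr mu0 pN). Qed.

Let q := \int[P]_t (G t ^+ 2).
Let v := q - e ^+ 2.

Let iZ (f : T -> R) k : P.-integrable setT (EFin \o f) ->
  P.-integrable setT (fun t => (k * f t)%:E).
Proof. by move=> /(integrableZl measurableT k). Qed.

Let iD (f g : T -> R) : P.-integrable setT (EFin \o f) -> P.-integrable setT (EFin \o g) ->
  P.-integrable setT (fun t => (f t + g t)%:E).
Proof. by move=> i j; exact: (integrableD measurableT i j). Qed.

Let i1 : P.-integrable setT (fun t => (1 : R)%:E).
Proof. exact: finite_measure_integrable_cst. Qed.

(** One expansion with three uses: [(1, c * e / mu)] gives Cauchy-Schwarz, [(1, 0)] identifies the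
    variance of [G], and the inverse standard deviations give the distance of [X] and [Y]. *)
Let quadratic_integral (u w : R) :
  P.-integrable setT (fun t => ((u * (G t - e) - w * ((N t)%:R - mu)) ^+ 2)%:E) /\
  \int[P]_t (u * (G t - e) - w * ((N t)%:R - mu)) ^+ 2 =
  u ^+ 2 * v - 2 * u * w * (c * e) + w ^+ 2 * mu.
Proof.
have E t : (u * (G t - e) - w * ((N t)%:R - mu)) ^+ 2 =
  u ^+ 2 * G t ^+ 2 + ((- 2 * u * w) * (G t * (N t)%:R) + (w ^+ 2 * (N t)%:R ^+ 2 +
  ((- 2 * u ^+ 2 * e + 2 * u * w * mu) * G t + ((2 * u * w * e - 2 * w ^+ 2 * mu) * (N t)%:R +
   (w * mu - u * e) ^+ 2 * 1)))) by ring.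
under eq_fun do rewrite E.
under eq_Rintegral do rewrite E.
have j1 := iZ (u ^+ 2) iG2; have j2 := iZ (- 2 * u * w) iGN.
have j3 := iZ (w ^+ 2) iN2; have j4 := iZ (- 2 * u ^+ 2 * e + 2 * u * w * mu) iG.
have j5 := iZ (2 * u * w * e - 2 * w ^+ 2 * mu) iN; have j6 := iZ ((w * mu - u * e) ^+ 2) i1.
have j56 := iD j5 j6; have j456 := iD j4 j56; have j3456 := iD j3 j456.
have j23456 := iD j2 j3456; have j := iD j1 j23456.
split; first exact: j.
rewrite RintegralD// RintegralD// RintegralD// RintegralD// RintegralD//.
rewrite !RintegralZl// Rintegral_prob_cst eE EGN EN EN2 -/q /v.
by ring.
Qed.

(* Cauchy-Schwarz inequality for the covariance c e of G and N. *)
Let v_ge : (c * e) ^+ 2 / mu <= v.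
Proof.
have [_] := quadratic_integral 1 (c * e / mu).
have : 0 <= \int[P]_t (1 * (G t - e) - c * e / mu * ((N t)%:R - mu)) ^+ 2.
  by apply: Rintegral_ge0 => t _; exact: sqr_ge0.
move=> h0 h1; move: h0; rewrite h1 -[in X in _ -> X]subr_ge0.
have -> : 1 ^+ 2 * v - 2 * 1 * (c * e / mu) * (c * e) + (c * e / mu) ^+ 2 * mu =
  v - (c * e) ^+ 2 / mu by field; rewrite gt_eqF.
by [].
Qed.

Let v_gt0 : 0 < v.
Proof. by apply: lt_le_trans v_ge; rewrite divr_gt0// exprn_gt0. Qed.

Let X t := (G t - e) / Num.sqrt v.
Let Y t := ((N t)%:R - mu) / Num.sqrt mu.

Let standardizeE : standardize P G = X.
Proof.
have EG : fine 'E_P[G]%E = e by rewrite unlock -eE.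
apply/funext => t; rewrite /standardize /X EG; congr (_ / Num.sqrt _).
rewrite /variance unlock EG.
have [_] := quadratic_integral 1 0.
rewrite expr1n expr0n mul1r !mul0r addr0 mulr0 mul0r subr0 => <-.
rewrite unlock; congr fine; apply: eq_integral => s _ /=.
by rewrite mul0r mul1r subr0 expr2.
Qed.

Let iX : P.-integrable setT (fun t => (X t)%:E).
Proof.
rewrite /X; under eq_fun do rewrite mulrC mulrBr.
by apply: iD; [exact: iZ|exact: finite_measure_integrable_cst].
Qed.

Let L2_dist : P.-integrable setT (fun t => ((X t - Y t) ^+ 2)%:E) /\
  \int[P]_t (X t - Y t) ^+ 2 <= 2 * (err * mu / (c * e) ^+ 2).
Proof.
have [i E] := quadratic_integral (Num.sqrt v)^-1 (Num.sqrt mu)^-1.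
have XY t : X t - Y t = (Num.sqrt v)^-1 * (G t - e) - (Num.sqrt mu)^-1 * ((N t)%:R - mu).
  by rewrite /X /Y; congr (_ - _); rewrite mulrC.
under eq_fun do rewrite XY.
under eq_Rintegral do rewrite XY.
split=> //; rewrite E.
have sv0 : 0 < Num.sqrt v by rewrite sqrtr_gt0.
have sm0 : 0 < Num.sqrt mu by rewrite sqrtr_gt0.
have sv2 : Num.sqrt v ^+ 2 = v by rewrite sqr_sqrtr// ltW.
have sm2 : Num.sqrt mu ^+ 2 = mu by rewrite sqr_sqrtr// ltW.
rewrite !exprVn sv2 sm2 !mulVf ?gt_eqF//.
(* r is the correlation of G and N, and 2 (1 - r) <= 2 (1 - r ^ 2). *)
pose r := c * e / (Num.sqrt v * Num.sqrt mu).
have r0 : 0 < r by rewrite divr_gt0// mulr_gt0.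
have r2 : r ^+ 2 = (c * e) ^+ 2 / mu / v.
  by rewrite /r expr_div_n !exprMn sv2 sm2; field; rewrite !gt_eqF.
have r21 : r ^+ 2 <= 1 by rewrite r2 ler_pdivrMr// mul1r.
have r1 : r <= 1 by rewrite -(@expr_le1 _ 2)// ltW.
have -> : 1 - 2 * (Num.sqrt v)^-1 * (Num.sqrt mu)^-1 * (c * e) + 1 = 2 * (1 - r).
  by rewrite /r invfM; ring.
rewrite ler_pM2l//; apply: (@le_trans _ _ (1 - r ^+ 2)); first nra.
have w0 : 0 < (c * e) ^+ 2 / mu by rewrite divr_gt0// exprn_gt0.
have er : v - (c * e) ^+ 2 / mu <= err by move: EG2; rewrite -/q /v; lra.
have er0 : 0 <= err by apply: le_trans er; rewrite subr_ge0.
rewrite r2 -[X in X - _](@divff _ v) ?gt_eqF// -mulrBl ler_pdivrMr//.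
apply: (le_trans er).
have -> : err * mu / (c * e) ^+ 2 = err / ((c * e) ^+ 2 / mu).
  by rewrite invf_div mulrA.
by rewrite mulrAC -mulrA ler_peMr// ler_pdivlMr// mul1r.
Qed.

(** [X] and [Y] live on the same space, so exchanging them under a 1-Lipschitz function costs E |X -
    Y|. The free parameter [s] stands in for the square root of E (X - Y)^2. *)
Lemma wasserstein_standardize_le (s : R) : 0 < s ->
  (wasserstein (pushforward P (standardize P G)) (normal_prob 0 1) <=
   ((s + 2 * (err * mu / (c * e) ^+ 2) / s) / 2 +
    (5 + 6 * @stein_const R) / Num.sqrt mu)%:E)%E.
Proof.
move=> s0; rewrite standardizeE; apply: ge_ereal_sup => _ [f /= Lf <-].
have {}Lf x y : `|f x - f y| <= `|x - y|.
  by have := Lf (x, y) (conj I I); rewrite /= mul1r.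
have mX : measurable_fun setT X.
  by apply/measurable_EFinP; exact: measurable_int iX.
have [ifY fYn] := poisson_rv_normal mu0 pN Lf.
have [iD2 D2] := L2_dist.
have iN1 := integrable_lipschitz1_normal Lf.
have mf := lipschitz1_measurable Lf.
have ifX : P.-integrable setT (fun t => (f (X t))%:E).
  have ib : P.-integrable setT (fun t => (`|f 0| + `|X t|)%:E).
    by apply: iD; [exact: finite_measure_integrable_cst|exact: integrable_abse iX].
  apply: (le_integrable measurableT _ _ ib).
    by apply/measurable_EFinP; exact: measurableT_comp.
  move=> t _; rewrite lee_fin [leRHS]ger0_norm ?addr_ge0//.
  have := Lf (X t) 0; rewrite subr0 => h.
  by have := ler_normD (f (X t) - f 0) (f 0); rewrite subrK; lra.
rewrite integral_pushforward//; last exact/measurable_EFinP.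
rewrite -[X in (`|X - _|)%E]fineK; last exact: integrable_fin_num ifX.
rewrite -[X in (`|_ - X|)%E]fineK; last exact: integrable_fin_num iN1.
rewrite -EFinB abse_EFin lee_fin.
set m := fine (\int[normal_prob 0 1]_x _)%E in fYn *.
have -> : fine (\int[P]_(x in X @^-1` setT) (EFin \o f \o X) x)%E = \int[P]_t f (X t).
  by rewrite preimage_setT.
rewrite -(subrK (\int[P]_t f (Y t)) (\int[P]_t f (X t))) -addrA.
apply: (le_trans (ler_normD _ _)); apply: lerD => //.
rewrite -RintegralB//.
have iB : P.-integrable setT (fun t => (f (X t) - f (Y t))%:E).
  exact: (integrableB measurableT ifX ifY).
apply: (le_trans (le_normr_Rintegral measurableT iB)).
(* AM-GM: |D| <= s / 2 + D ^ 2 / (2 s) for D = X t - Y t. *)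
apply: (@le_trans _ _ (\int[P]_t (s / 2 * 1 + (2 * s)^-1 * (X t - Y t) ^+ 2))).
  apply: le_Rintegral => //.
  - exact: integrable_abse iB.
  - exact: (iD (iZ (s / 2) i1) (iZ (2 * s)^-1 iD2)).
  - move=> t _; apply: (le_trans (Lf _ _)).
    set D := X t - Y t.
    have : 0 <= (`|D| - s) ^+ 2 / (2 * s) by rewrite divr_ge0 ?sqr_ge0// mulr_ge0// ltW.
    rewrite sqrrB real_normK ?num_real//.
    have -> : (D ^+ 2 - `|D| * s *+ 2 + s ^+ 2) / (2 * s) =
       (2 * s)^-1 * D ^+ 2 + s / 2 * 1 - `|D|.
      by rewrite -mulr_natr; field; rewrite gt_eqF.
    by rewrite subr_ge0 addrC.
rewrite RintegralD//; last 2 first.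
- exact: (iZ (s / 2) i1).
- exact: (iZ (2 * s)^-1 iD2).
rewrite !RintegralZl// Rintegral_prob_cst mulr1 [leRHS]mulrDl lerD2l.
have -> : 2 * (err * mu / (c * e) ^+ 2) / s / 2 = (2 * s)^-1 * (2 * (err * mu / (c * e) ^+ 2)).
  by move: (err * mu / _) => w; rewrite invfM; ring.
by rewrite ler_pM2l// invr_gt0 mulr_gt0.
Qed.

End wasserstein_bound.

(** * From grid counts to the number of occurrences *)

Section process.
Context dT (T : measurableType dT) (R : realType) (P : probability T R).
Variables (d : nat) (a lambda : R).
Local Notation borelR := (measurableTypeR R).
Local Notation point := (d.-tuple borelR).
Variable omega : T -> {fset point}.
Hypotheses (a0 : 0 < a) (lambda0 : 0 < lambda).
Hypothesis process : poisson_process a P lambda omega.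

Lemma poisson_process_rv (A : set point) :
  measurable A -> A `<=` torus a -> 0 < fine (lebesgue_tuple d A) ->
  poisson_rv P (lambda * fine (lebesgue_tuple d A)) (fun t => nb_points A (omega t)).
Proof.
move=> mA AT A0; split; first exact: (measurable_nb_points process mA AT).
move=> k; have /(congr1 (fun nu => nu [set k])) := poisson_nb_points process mA AT.
rewrite /pushforward => ->; rewrite /poisson_prob mulr_gt0//.
by rewrite esum_set1// lee_fin poisson_pmf_ge0.
Qed.

Let omT t x : x \in omega t -> torus a x.
Proof. exact: (poisson_process_torus process). Qed.

Lemma poisson_process_card : poisson_rv P (lambda * a ^+ d) (fun t => #|` omega t|).
Proof.
have mT : measurable (@torus R d a) by exact: measurable_torus.
have := poisson_process_rv mT (@subset_refl _ _).
rewrite lebesgue_torus//= => /(_ (exprn_gt0 _ a0)).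
congr poisson_rv; apply/funext => t; apply: nb_points_torus; exact: omT.
Qed.

Section grid.
Variable m : nat.
Let K := {ffun 'I_d -> 'I_m.+1}.
Let dl : R := lambda * (a / m.+1%:R) ^+ d.
Let X (k : K) t := nb_points (cell a k) (omega t).

Lemma grid_intensity_gt0 : 0 < dl.
Proof. by rewrite mulr_gt0// exprn_gt0// divr_gt0. Qed.

Lemma grid_intensity_card : dl * #|K|%:R = lambda * a ^+ d.
Proof. by rewrite /dl -mulrA eta_card. Qed.

Lemma grid_poisson k : poisson_rv P dl (X k).
Proof.
have mk : measurable (cell a k) by exact: measurable_cell.
have := poisson_process_rv mk (cell_torus a0 (k := k)).
by rewrite lebesgue_cell//=; apply; rewrite exprn_gt0// divr_gt0.
Qed.

Lemma grid_independent (h : K -> nat -> R) (e : K -> R) :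
  (forall x k, 0 <= h x k) ->
  (forall x, \int[P]_t (h x (X x t))%:E = (e x)%:E)%E ->
  (\int[P]_t (\prod_x h x (X x t))%:E = (\prod_x e x)%:E)%E.
Proof.
move=> h0 hE.
have := @integral_prod_independent _ _ _ P #|K| (fun i => X (enum_val i)) _ _
  (fun i => h (enum_val i)) (fun i => e (enum_val i)).
rewrite -(big_enum_val e) => H.
under eq_integral do rewrite (big_enum_val (fun x => h x (X x _))).
apply: H => //.
- by move=> i; exact: (grid_poisson _).1.
- move=> k.
  apply: (independent_nb_points process (A := fun i => cell a (enum_val i))).
  + by move=> i; exact: measurable_cell.
  + by move=> i; exact: cell_torus.
  + apply/trivIsetP => i j _ _ ij.
    have /trivIsetP := @trivIset_cell _ _ _ a0 m (setT : set K).
    by apply => //; apply: contra_neq ij; exact: enum_val_inj.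
Qed.

End grid.

Variables (eps : R) (n : nat) (Gamma : simplicial_complex 'I_n).

Let N t := #|` omega t|.
Let G t := nb_occurrences a eps Gamma (omega t).
Let mu := lambda * a ^+ d.
Let Gm m t := pattern_count (@grid_kernel R d a eps n Gamma m)
  (fun k => nb_points (cell a k) (omega t)).
Let em m := \int[P]_t Gm m t.

Let mu0 : 0 < mu. Proof. by rewrite mulr_gt0// exprn_gt0. Qed.

Let measurable_Gm m : measurable_fun setT (Gm m).
Proof.
apply: measurable_sum => k; apply: measurable_funM => //.
apply: measurable_prod => i _; exact: measurableT_comp (grid_poisson _).1.
Qed.

Let Gm_ge0 m t : 0 <= Gm m t.
Proof.
by apply: sumr_ge0 => k _; rewrite mulr_ge0 ?prodr_ge0//; exact: grid_kernel_ge0.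
Qed.

Let G_ge0 t : 0 <= G t.
Proof. by have /andP[] := nb_occurrences_le a eps Gamma (omega t). Qed.

Let Gm_le m t : Gm m t <= G t.
Proof. by apply: grid_count_le => //; exact: omT. Qed.

Let G_le t : G t <= (N t).+1%:R ^+ n.
Proof.
have /andP[_ h] := nb_occurrences_le a eps Gamma (omega t).
by apply: (le_trans h); rewrite lerXn2r ?nnegrE// ler_nat.
Qed.

Let N_le t : (N t)%:R <= (N t).+1%:R :> R. Proof. by rewrite ler_nat. Qed.

Let cvg_Gm t : Gm m t @[m --> \oo] --> G t.
Proof. by apply: cvg_near_cst; apply: grid_count_near => // x; exact: omT. Qed.

Let iNexp j : P.-integrable setT (EFin \o (fun t => ((N t).+1%:R ^+ j))).
Proof. exact: (poisson_rv_integrable_exp j mu0 poisson_process_card). Qed.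

Let measurable_N : measurable_fun setT (fun t => (N t)%:R : R).
Proof. exact: measurableT_comp poisson_process_card.1. Qed.

Let Gm_mean m : em m = (lambda * (a / m.+1%:R) ^+ d) ^+ n *
  \sum_k @grid_kernel R d a eps n Gamma m k.
Proof.
rewrite /em /Rintegral (pattern_count_mean (grid_intensity_gt0 m) (grid_poisson (m:=m))
  (grid_independent (m:=m)))//.
- by move=> k; exact: grid_kernel_ge0.
- by move=> k; exact: grid_kernel_inj.
Qed.

Let Gm_total_mean m : \int[P]_t (Gm m t * (N t)%:R) = em m * (mu + n%:R).
Proof.
rewrite Gm_mean /Rintegral.
under eq_integral do rewrite -(total_countE a0 m (@omT _)).
rewrite (pattern_count_total_mean (grid_intensity_gt0 m) (grid_poisson (m:=m))
  (grid_independent (m:=m)))//= ?grid_intensity_card//.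
- by move=> k; exact: grid_kernel_ge0.
- by move=> k; exact: grid_kernel_inj.
Qed.

Let Gm_sqr_mean m :
  \int[P]_t (Gm m t ^+ 2) <= em m ^+ 2 + (n%:R * em m) ^+ 2 / mu + pattern_error n mu.
Proof.
rewrite Gm_mean /Rintegral -[leRHS]/(fine _%:E) fine_le//.
- apply: (integrable_fin_num measurableT).
  apply: (le_integrable measurableT _ _ (iNexp (n * 2))).
    by apply/measurable_EFinP; exact: measurable_funX.
  move=> t _; rewrite lee_fin !ger0_norm ?sqr_ge0 ?exprn_ge0//.
  rewrite exprM lerXn2r ?nnegrE ?exprn_ge0//.
  exact: le_trans (Gm_le m t) (G_le t).
- rewrite -[mu](grid_intensity_card m).
  apply: (pattern_count_sqr_mean (grid_intensity_gt0 m) (grid_poisson (m:=m))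
  (grid_independent (m:=m))).
  + by move=> k; exact: grid_kernel_ge0.
  + by move=> k; exact: grid_kernel_le1.
  + by move=> k; exact: grid_kernel_inj.
  + by move=> i x y; exact: grid_kernel_translate.
  + by apply/card_gt0P; exists 0.
Qed.

Let cvg_mean : P.-integrable setT (EFin \o G) /\ em m @[m --> \oo] --> \int[P]_t G t.
Proof.
apply: (cvg_Rintegral measurable_Gm cvg_Gm (iNexp n)) => m t.
by rewrite ger0_norm//; exact: le_trans (Gm_le m t) (G_le t).
Qed.

Let cvg_total_mean : P.-integrable setT (EFin \o (fun t => G t * (N t)%:R)) /\
  \int[P]_t (Gm m t * (N t)%:R) @[m --> \oo] --> \int[P]_t (G t * (N t)%:R).
Proof.
apply: (@cvg_Rintegral _ _ _ P (fun m t => Gm m t * (N t)%:R) _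
  (fun t => (N t).+1%:R ^+ n.+1)).
- by move=> m; exact: measurable_funM.
- by move=> t; apply: cvgM => //; exact: cvg_cst.
- exact: iNexp.
- move=> m t; rewrite ger0_norm ?mulr_ge0// exprSr.
  by apply: ler_pM => //; exact: le_trans (Gm_le m t) (G_le t).
Qed.

Let cvg_sqr_mean : P.-integrable setT (EFin \o (fun t => G t ^+ 2)) /\
  \int[P]_t (Gm m t ^+ 2) @[m --> \oo] --> \int[P]_t (G t ^+ 2).
Proof.
apply: (@cvg_Rintegral _ _ _ P (fun m t => Gm m t ^+ 2) _
  (fun t => (N t).+1%:R ^+ (n * 2))).
- by move=> m; exact: measurable_funX.
- by move=> t; under eq_fun do rewrite expr2; rewrite expr2; apply: cvgM.
- exact: iNexp.
- move=> m t; rewrite ger0_norm ?sqr_ge0// exprM lerXn2r ?nnegrE ?exprn_ge0//.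
  exact: le_trans (Gm_le m t) (G_le t).
Qed.

Let e := \int[P]_t G t.

Lemma occurrences_total_mean : \int[P]_t (G t * (N t)%:R) = e * (mu + n%:R).
Proof.
have [_ h] := cvg_total_mean; have [_ h'] := cvg_mean.
have h2 : \int[P]_t (Gm m t * (N t)%:R) @[m --> \oo] --> e * (mu + n%:R).
  under eq_fun do rewrite Gm_total_mean.
  by apply: cvgM => //; exact: cvg_cst.
exact: (cvg_unique _ h h2).
Qed.

Lemma occurrences_sqr_mean :
  \int[P]_t (G t ^+ 2) <= e ^+ 2 + (n%:R * e) ^+ 2 / mu + pattern_error n mu.
Proof.
have [_ h] := cvg_sqr_mean; have [_ h'] := cvg_mean.
apply: (ler_cvg_to h); last by apply: nearW => m; exact: Gm_sqr_mean.
apply: cvgD; last exact: cvg_cst.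
apply: cvgD; first by under eq_fun do rewrite expr2; rewrite expr2; apply: cvgM.
apply: cvgM; last exact: cvg_cst.
under eq_fun do rewrite expr2; rewrite expr2.
by apply: cvgM; apply: cvgM => //; exact: cvg_cst.
Qed.

(** Any single grid bounds the mean from below; for fixed [m] the bound is a constant times
    [lambda ^+ n]. *)
Lemma occurrences_mean_ge m :
  (lambda * (a / m.+1%:R) ^+ d) ^+ n * \sum_k @grid_kernel R d a eps n Gamma m k <= e.
Proof.
rewrite -Gm_mean; have [i _] := cvg_mean; apply: le_Rintegral => //.
apply: (le_integrable measurableT _ _ i); first exact/measurable_EFinP.
by move=> t _; rewrite lee_fin !ger0_norm.
Qed.

Lemma occurrences_wasserstein (s : R) : 0 < s -> 0 < n%:R * e ->
  (wasserstein (pushforward P (standardize P G)) (normal_prob 0 1) <=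
   ((s + 2 * (pattern_error n mu * mu / (n%:R * e) ^+ 2) / s) / 2 +
    (5 + 6 * @stein_const R) / Num.sqrt mu)%:E)%E.
Proof.
move=> s0 ne0.
apply: (wasserstein_standardize_le mu0 poisson_process_card cvg_mean.1
  cvg_total_mean.1 cvg_sqr_mean.1 erefl occurrences_total_mean occurrences_sqr_mean ne0 s0).
Qed.

End process.

(** * Positivity of the mean and final constants *)

Lemma torus_distxx (R : realType) d (a : R) (x : d.-tuple (measurableTypeR R)) :
  torus_dist a x x <= 0.
Proof.
apply: (@le_trans _ _ `|\row_(i < d) ((tnth x i : R) - tnth x i + ((fun=> 0) i)%:~R * a)|).
  apply: ge_inf; last by exists (fun=> 0).
  by exists 0 => _ [? _ <-].
rewrite (_ : \row_(i < d) _ = 0) ?normr0//.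
by apply/rowP => i; rewrite !mxE mul0r addr0 subrr.
Qed.

(** The vertices are put in consecutive cells along the first axis of a fine grid, all so close that
    every possible edge appears, whatever [Gamma] is. *)
Lemma grid_kernel_pos (R : realType) (d n : nat) (a eps : R)
    (Gamma : simplicial_complex 'I_n) :
  (0 < d)%N -> 0 < a -> 0 < eps ->
  exists m, exists k, 0 < @grid_kernel R d a eps n Gamma m k.
Proof.
case: d => // d _ a0 eps0.
(* [m >= n] leaves room for [n] distinct cells on the axis; the second term makes [n + 1] cell sides
   shorter than [eps]. *)
pose m := maxn n (Num.truncn (n.+1%:R * a / eps)); exists m.
have eta0 : 0 < a / m.+1%:R by rewrite divr_gt0.
have m_eps : n.+1%:R * (a / m.+1%:R) < eps.
  rewrite mulrA ltr_pdivrMr// [ltRHS]mulrC -ltr_pdivrMr//.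
  have x0 : 0 <= n.+1%:R * a / eps by rewrite divr_ge0 ?(ltW eps0)// mulr_ge0// ltW.
  have /andP[_ /lt_le_trans] := truncn_itv x0; apply.
  by rewrite ler_nat ltnS leq_maxr.
have lt_m (i : 'I_n) : (i < m.+1)%N.
  by rewrite ltnS (leq_trans (ltnW (ltn_ord i)))// leq_maxl.
pose k : {ffun 'I_n -> {ffun 'I_d.+1 -> 'I_m.+1}} :=
  [ffun i : 'I_n => [ffun c => if c == ord0 then inord i else ord0]].
exists k; rewrite /grid_kernel.
have -> : injectiveb k.
  apply/injectiveP => i j; rewrite !ffunE => /ffunP/(_ ord0).
  by rewrite !ffunE eqxx => /(congr1 val); rewrite /= !inordK// => /val_inj.
rewrite big1 ?div1r ?invr_gt0 ?ltr0n ?nb_symmetries_gt0// => -[i j] _ /=.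
suff -> : torus_dist a (corner a (k i)) (corner a (k j)) + a / m.+1%:R < 2 * eps by [].
have : torus_dist a (corner a (k i)) (corner a (k j)) <=
    torus_dist a (corner a (k i)) (corner a (k i)) + n%:R * (a / m.+1%:R).
  apply: (torus_dist_le (z := fun=> 0)) => [|c]; first by rewrite mulr_ge0// ltW.
  rewrite mul0r subr0 subrr sub0r normrN !tnth_mktuple -mulrBr normrM (gtr0_norm eta0).
  rewrite mulrC ler_wpM2r ?(ltW eta0)// !ffunE; case: ifP => _; last first.
    by rewrite subrr normr0.
  rewrite !inordK// ler_norml.
  have : (i%:R : R) <= n%:R by rewrite ler_nat ltnW.
  have : (j%:R : R) <= n%:R by rewrite ler_nat ltnW.
  have : (0 : R) <= i%:R by [].
  have : (0 : R) <= j%:R by [].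
  by move=> ? ? ? ?; apply/andP; split; lra.
have := torus_distxx a (corner a (k i)).
move: m_eps; rewrite -natr1 mulrDl mul1r.
generalize (torus_dist a (corner a (k i)) (corner a (k i))).
generalize (torus_dist a (corner a (k i)) (corner a (k j))).
generalize (n%:R * (a / m.+1%:R)) (a / m.+1%:R) => w z u v h1 h2 h3.
clear -eps0 h1 h2 h3; lra.
Qed.

(** All exponents are at most 2n - 2 because [#|A| >= 2], and [lambda >= 1]. The natural subtraction
    truncates only for [n = 0], when the sum is empty. *)
Lemma pattern_error_scale (R : realType) n (lambda V : R) : 1 <= lambda -> 0 <= V ->
  pattern_error n (lambda * V) <= lambda ^+ (n + n - 2) * pattern_error n V.
Proof.
move=> l1 V0; rewrite /pattern_error mulr_sumr; apply: ler_sum => A A1.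
have An : (#|A| <= n)%N by rewrite -[leqRHS]card_ord max_card.
rewrite mulrCA ler_wpM2l ?exprn_ge0// exprMn ler_wpM2r ?exprn_ge0//.
by rewrite ler_weXn2l//; lia.
Qed.

Theorem theorem22 (R : realType) (d n : nat) (a eps : R)
    (Gamma : simplicial_complex 'I_n)
    (d_ge1 : (1 <= d)%N) (n_ge1 : (1 <= n)%N)
    (a_gt0 : 0 < a) (eps_gt0 : 0 < eps) (eps_lt : eps < a / 4)
    (Gamma_connected : connected_complex Gamma) :
  exists2 c : R, 0 < c &
    forall (dT : measure_display) (T : measurableType dT)
      (P : probability T R) (lambda : R)
      (omega : T -> {fset d.-tuple (measurableTypeR R)}),
      1 <= lambda -> poisson_process a P lambda omega ->
      let G := fun t => nb_occurrences a eps Gamma (omega t) in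
      (wasserstein (pushforward P (standardize P G)) (normal_prob 0 1)
        <= (c / Num.sqrt lambda)%:E)%E.
Proof.
have [m [k0 k0_gt0]] := grid_kernel_pos Gamma d_ge1 a_gt0 eps_gt0.
(* The mean will be at least [lambda ^+ n * kappa]; the grid is fixed before [lambda], so [kappa]
   does not depend on it. *)
pose kappa := ((a / m.+1%:R) ^+ d) ^+ n * \sum_k @grid_kernel R d a eps n Gamma m k.
have kappa0 : 0 < kappa.
  rewrite mulr_gt0// ?exprn_gt0 ?divr_gt0//.
  rewrite (bigD1 k0)//= ltr_wpDr// sumr_ge0// => k _; exact: grid_kernel_ge0.
pose V := a ^+ d; have V0 : 0 < V by rewrite exprn_gt0.
have sV0 : 0 < Num.sqrt V by rewrite sqrtr_gt0.
pose B : R := 5 + 6 * stein_const.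
have B0 : 0 <= B by rewrite /B; have := @stein_const_ge0 R; lra.
have E0 : 0 <= pattern_error n V.
  by apply: sumr_ge0 => A _; rewrite mulr_ge0 ?exprn_ge0// ltW.
pose Q := pattern_error n V * V / kappa ^+ 2.
have Q0 : 0 <= Q by rewrite divr_ge0 ?sqr_ge0// mulr_ge0// ltW.
exists ((1 + 2 * Q) / 2 + B / Num.sqrt V).
  by rewrite ltr_wpDr ?divr_ge0 ?(ltW sV0)// divr_gt0// ltr_wpDr// mulr_ge0.
move=> dT T P lambda omega l1 process /=.
have l0 : 0 < lambda by lra.
set r := Num.sqrt lambda; have r0 : 0 < r by rewrite sqrtr_gt0.
have rr : lambda = r ^+ 2 by rewrite sqr_sqrtr// ltW.
set e := \int[P]_t nb_occurrences a eps Gamma (omega t).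
have ek : lambda ^+ n * kappa <= e.
  have := occurrences_mean_ge a_gt0 l0 process eps Gamma m.
  by rewrite exprMn -mulrA.
have lk0 : 0 < lambda ^+ n * kappa by rewrite mulr_gt0// exprn_gt0.
have ne : lambda ^+ n * kappa <= n%:R * e.
  by apply: (le_trans ek); rewrite ler_peMl ?ler1n// (le_trans _ ek)// ltW.
have ne0 : 0 < n%:R * e by apply: lt_le_trans ne.
(* The choice [s = lambda ^ (-1/2)] balances [s] against an error of order [1 / lambda] divided by
   [s]. *)
have s0 : 0 < r^-1 by rewrite invr_gt0.
apply: (le_trans (occurrences_wasserstein a_gt0 l0 process s0 ne0)).
rewrite lee_fin -/V -/B -/e [leRHS]mulrDl; apply: lerD; last first.
  by rewrite sqrtrM ?(ltW l0)// -/r invfM mulrA mulrAC.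
(* Power count: the error has order 2n - 2 in [lambda], the factor [mu] adds 1 and the squared mean
   removes 2n, which leaves [1 / lambda]. *)
have H : pattern_error n (lambda * V) * (lambda * V) / (n%:R * e) ^+ 2 <= Q / r ^+ 2.
  rewrite ler_pdivrMr ?exprn_gt0//.
  apply: (@le_trans _ _ (lambda ^+ (n + n - 2) * pattern_error n V * (lambda * V))).
    apply: ler_wpM2r; first by rewrite mulr_ge0// ltW.
    by apply: pattern_error_scale => //; exact: ltW.
  apply: (@le_trans _ _ (Q / r ^+ 2 * (lambda ^+ n * kappa) ^+ 2)); last first.
    apply: ler_wpM2l; first by rewrite divr_ge0 ?sqr_ge0.
    by rewrite lerXn2r// nnegrE ltW.
  rewrite -rr /Q le_eqVlt; apply/orP; left; apply/eqP.
  have -> : (lambda ^+ n * kappa) ^+ 2 = lambda ^+ (n + n - 2) * lambda ^+ 2 * kappa ^+ 2.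
    by rewrite exprMn -exprM -exprD muln2 -addnn subnK// -[2%N]addn1 leq_add.
  rewrite -/V.
  move: (lambda ^+ (n + n - 2)) (pattern_error n V) => x y.
  have k_neq0 : kappa != 0 by rewrite gt_eqF.
  have l_neq0 : lambda != 0 by rewrite gt_eqF.
  move: k_neq0 l_neq0; generalize kappa, V, lambda => k v l k_neq0 l_neq0.
  by field; apply/andP; split.
rewrite -[leRHS](_ : (r^-1 + 2 * (Q / r ^+ 2) / r^-1) / 2 = _); last first.
  by field; rewrite gt_eqF.
rewrite ler_pM2r// lerD2l invrK ler_pM2r// ler_pM2l//.
Qed.
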